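(* Let $I$ be the cover ideal of a graph $\mathcal G$. Then $R/I^2$ satisfies Serre's condition $(S_2)$ if and only if $I$ is a complete intersection.
   Context: Let $k$ be a field and $R=k[x_1,\dots,x_n]$ the polynomial ring. A graph $\mathcal G$ on the vertex set $V=\{1,\dots,n\}$ is a collection of 2-element subsets of $V$, called edges. For $C\subseteq V$, $P_C$ denotes the ideal of $R$ generated by the variables $x_i$, $i\in C$. The cover ideal of $\mathcal G$ is the intersection of all ideals $P_C$ with $C\in\mathcal G$. A ring $S$ satisfies Serre's condition $(S_2)$ if $\operatorname{depth} S_P\ge\min\{2,\operatorname{ht}P\}$ for every prime ideal $P$ of $S$. The ideal $I$ is a complete intersection if it is generated by an $R$-regular sequence. *)

(* Defs.v *)
From HB Require Import structures.
From mathcomp Require Import all_boot all_order all_algebra.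
From mathcomp Require Import ring boolp classical_sets mpoly.

Set Implicit Arguments.
Unset Strict Implicit.
Unset Printing Implicit Defensive.

Import GRing.Theory.
Local Open Scope ring_scope.
Local Open Scope quotient_scope.
Local Open Scope classical_set_scope.

(** * Ideals *)

(* Arbitrary ideals of possibly trivial commutative rings, unlike the proper
   and decidable [idealr] of [ring_quotient]. *)
Record ideal (R : comPzRingType) := Ideal {
  ideal_set :> R -> Prop;
  ideal0 : ideal_set 0;
  idealD : forall a b, ideal_set a -> ideal_set b -> ideal_set (a + b);
  idealM : forall a b, ideal_set b -> ideal_set (a * b)
}.

Record prime_ideal (R : comPzRingType) := PrimeIdeal {
  prime_ideal_ideal :> ideal R;
  prime1 : ~ prime_ideal_ideal 1;
  primeM : forall a b, prime_ideal_ideal (a * b) ->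
    prime_ideal_ideal a \/ prime_ideal_ideal b
}.

Section IdealTheory.
Variables (R : comPzRingType) (I : ideal R).

Lemma idealN a : I a -> I (- a).
Proof. by move=> Ia; rewrite -mulN1r; apply: idealM. Qed.

Definition mem_ideal : {pred R} := fun a => `[< I a >].

Lemma mem_idealP a : reflect (I a) (a \in mem_ideal).
Proof. exact: asboolP. Qed.

Lemma mem_ideal_zmod_closed : zmod_closed mem_ideal.
Proof.
split=> [|a b /mem_idealP Ia /mem_idealP Ib]; apply/mem_idealP.
  exact: ideal0.
by apply: idealD => //; apply: idealN.
Qed.

HB.instance Definition _ :=
  GRing.isZmodClosed.Build R mem_ideal mem_ideal_zmod_closed.

End IdealTheory.

Section Generated.
Variable R : comPzRingType.

(* Each pair in [s] consists of a coefficient and a generator. *)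
Definition lincomb (X : set R) : set R := [set f | exists s : seq (R * R),
  (forall p, p \in s -> X p.2) /\ f = \sum_(p <- s) p.1 * p.2].

Lemma lincomb0 X : lincomb X 0.
Proof. by exists [::]; rewrite big_nil. Qed.

Lemma lincombD X a b : lincomb X a -> lincomb X b -> lincomb X (a + b).
Proof.
move=> [s [sX ->]] [t [tX ->]]; exists (s ++ t); rewrite big_cat; split=> // p.
by rewrite mem_cat => /orP[/sX|/tX].
Qed.

Lemma lincombM X a b : lincomb X b -> lincomb X (a * b).
Proof.
move=> [s [sX ->]]; exists [seq (a * p.1, p.2) | p <- s]; split.
  by move=> p /mapP[q /sX qX ->].
by rewrite big_map mulr_sumr; apply: eq_bigr => p _; rewrite mulrA.
Qed.

Definition ideal_gen (X : set R) : ideal R :=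
  Ideal (lincomb0 X) (@lincombD X) (@lincombM X).

Definition ideal_mul (I J : ideal R) : ideal R :=
  ideal_gen [set f | exists a b, [/\ I a, J b & f = a * b]].

End Generated.

(** * Quotient rings *)

Section QuotientRing.
Variables (R : comPzRingType) (I : ideal R).

(* The additive quotient is that of the library, which however has a
   multiplication only for proper ideals of nontrivial rings. *)
Definition quot_ring : Type := Quotient.quot (mem_ideal I).

HB.instance Definition _ := GRing.Zmodule.on quot_ring.
HB.instance Definition _ := EqQuotient.on quot_ring.

Definition quot_proj (a : R) : quot_ring := \pi_quot_ring a.

Lemma quot_projP a b : quot_proj a = quot_proj b <-> I (a - b).
Proof.
rewrite (rwP eqP) /quot_proj -Quotient.idealrBE.
by split=> /mem_idealP.
Qed.

Lemma quot_projW (T : quot_ring -> Prop) :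
  (forall a, T (quot_proj a)) -> forall x, T x.
Proof. by move=> Tp x; rewrite -[x]reprK; apply: Tp. Qed.

Lemma quot_projD a b : quot_proj (a + b) = quot_proj a + quot_proj b.
Proof. exact: Quotient.pi_add. Qed.

Definition quot_one : quot_ring := quot_proj 1.
Definition quot_mul (x y : quot_ring) : quot_ring :=
  quot_proj (repr x * repr y).

Lemma quot_projM a b :
  quot_mul (quot_proj a) (quot_proj b) = quot_proj (a * b).
Proof.
apply/quot_projP.
set a' := repr (quot_proj a); set b' := repr (quot_proj b).
have Ia : I (a' - a) by apply/quot_projP; rewrite /quot_proj /a' reprK.
have Ib : I (b' - b) by apply/quot_projP; rewrite /quot_proj /b' reprK.
have -> : a' * b' - a * b = b' * (a' - a) + a * (b' - b) by ring.
by apply: idealD; apply: idealM.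
Qed.

Lemma quot_mulA : associative quot_mul.
Proof.
by elim/quot_projW=> a; elim/quot_projW=> b; elim/quot_projW=> c;
  rewrite !quot_projM mulrA.
Qed.

Lemma quot_mulC : commutative quot_mul.
Proof.
by elim/quot_projW=> a; elim/quot_projW=> b; rewrite !quot_projM mulrC.
Qed.

Lemma quot_mul1 : left_id quot_one quot_mul.
Proof. by elim/quot_projW=> a; rewrite quot_projM mul1r. Qed.

Lemma quot_mulDl : left_distributive quot_mul +%R.
Proof.
by elim/quot_projW=> a; elim/quot_projW=> b; elim/quot_projW=> c;
  rewrite -quot_projD !quot_projM mulrDl quot_projD.
Qed.

HB.instance Definition _ := GRing.Zmodule_isComPzRing.Build quot_ring
  quot_mulA quot_mulC quot_mul1 quot_mulDl.

End QuotientRing.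

(** * Localization at a prime ideal *)

Section Localization.
Variables (S : comPzRingType) (P : prime_ideal S).

Definition denom : Type := {s : S | s \notin mem_ideal P}.

HB.instance Definition _ := SubChoice.on denom.

Definition den (s : denom) : S := val s.

Lemma denomP (s : denom) : ~ P (den s).
Proof. by case: s => s sP /mem_idealP; apply/negP. Qed.

Lemma denom1_subproof : 1 \notin mem_ideal P.
Proof. by apply/negP => /mem_idealP; exact: prime1. Qed.

Lemma primeNM a b : ~ P a -> ~ P b -> ~ P (a * b).
Proof. by move=> Pa Pb /primeM[]. Qed.

Lemma denomM_subproof (s t : denom) : den s * den t \notin mem_ideal P.
Proof.
by apply/negP => /mem_idealP; apply: primeNM; exact: denomP.
Qed.

Definition denom1 : denom := Sub 1 denom1_subproof.
Definition denomM (s t : denom) : denom :=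
  Sub (den s * den t) (denomM_subproof s t).

Lemma den1 : den denom1 = 1. Proof. by rewrite /den SubK. Qed.

Lemma denM s t : den (denomM s t) = den s * den t.
Proof. by rewrite /den SubK. Qed.

Definition loc_equiv : rel (S * denom) := fun x y =>
  `[< exists2 u, ~ P u & u * (x.1 * den y.2 - y.1 * den x.2) = 0 >].

Lemma loc_equiv_class : equiv_class_of loc_equiv.
Proof.
split=> [x|x y|y x z].
- by apply/asboolP; exists 1; [exact: prime1 | rewrite subrr mulr0].
- by apply/asboolP/asboolP=> -[u Pu e]; exists u => //;
    rewrite -opprB mulrN e oppr0.
- move=> /asboolP[u Pu e] /asboolP[v Pv f]; apply/asboolP.
  exists (u * v * den y.2).
    by do !apply: primeNM; rewrite //; apply: denomP.
  transitivity (v * den z.2 * (u * (x.1 * den y.2 - y.1 * den x.2)) +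
    u * den x.2 * (v * (y.1 * den z.2 - z.1 * den y.2))); first by ring.
  by rewrite e f !mulr0 addr0.
Qed.

Canonical loc_equivRel := EquivRelPack loc_equiv_class.
Canonical loc_encModRel := defaultEncModRel loc_equiv.

Definition localization : Type := {eq_quot loc_equiv}.

HB.instance Definition _ := Choice.on localization.
HB.instance Definition _ := EqQuotient.on localization.

(* [loc_frac a s] is the fraction a / s. *)
Definition loc_frac (a : S) (s : denom) : localization :=
  \pi_localization (a, s).

Lemma loc_fracP a s b t : loc_frac a s = loc_frac b t <->
  exists2 u, ~ P u & u * (a * den t - b * den s) = 0.
Proof.
split=> [/eqP|h]; last by apply/eqP; rewrite /loc_frac piE; apply/asboolP.
by rewrite /loc_frac piE => /asboolP.
Qed.

Lemma loc_fracW (T : localization -> Prop) :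
  (forall a s, T (loc_frac a s)) -> forall x, T x.
Proof. by move=> Tp x; rewrite -[x]reprK; case: (repr x). Qed.

Lemma loc_repr a s : exists2 u, ~ P u &
  u * ((repr (loc_frac a s)).1 * den s - a * den (repr (loc_frac a s)).2) = 0.
Proof.
by apply/loc_fracP; rewrite /loc_frac -surjective_pairing reprK.
Qed.

Lemma loc_frac_eq a s b t : a * den t = b * den s ->
  loc_frac a s = loc_frac b t.
Proof.
move=> e; apply/loc_fracP; exists 1; first exact: prime1.
by rewrite e subrr mulr0.
Qed.

Definition loc_zero : localization := loc_frac 0 denom1.
Definition loc_one : localization := loc_frac 1 denom1.
Definition loc_opp (x : localization) : localization :=
  loc_frac (- (repr x).1) (repr x).2.
Definition loc_add (x y : localization) : localization :=
  loc_frac ((repr x).1 * den (repr y).2 + (repr y).1 * den (repr x).2)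
    (denomM (repr x).2 (repr y).2).
Definition loc_mul (x y : localization) : localization :=
  loc_frac ((repr x).1 * (repr y).1) (denomM (repr x).2 (repr y).2).

Lemma loc_oppE a s : loc_opp (loc_frac a s) = loc_frac (- a) s.
Proof.
have [u Pu e] := loc_repr a s; apply/loc_fracP; exists u => //.
by rewrite !mulNr -opprD mulrN e oppr0.
Qed.

Lemma loc_addE a s b t : loc_add (loc_frac a s) (loc_frac b t) =
  loc_frac (a * den t + b * den s) (denomM s t).
Proof.
have [u Pu] := loc_repr a s; have [v Pv] := loc_repr b t.
rewrite /loc_add; case: (repr _) => b' t' /= f; case: (repr _) => a' s' /= e.
apply/loc_fracP; exists (u * v); rewrite /= ?denM; first exact: primeNM.
transitivity (v * den t * den t' * (u * (a' * den s - a * den s')) +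
  u * den s * den s' * (v * (b' * den t - b * den t'))); first by ring.
by rewrite e f !mulr0 addr0.
Qed.

Lemma loc_mulE a s b t : loc_mul (loc_frac a s) (loc_frac b t) =
  loc_frac (a * b) (denomM s t).
Proof.
have [u Pu] := loc_repr a s; have [v Pv] := loc_repr b t.
rewrite /loc_mul; case: (repr _) => b' t' /= f; case: (repr _) => a' s' /= e.
apply/loc_fracP; exists (u * v); rewrite /= ?denM; first exact: primeNM.
transitivity (v * den t * b' * (u * (a' * den s - a * den s')) +
  u * a * den s' * (v * (b' * den t - b * den t'))); first by ring.
by rewrite e f !mulr0 addr0.
Qed.

Lemma loc_addA : associative loc_add.
Proof.
elim/loc_fracW=> a s; elim/loc_fracW=> b t; elim/loc_fracW=> c u.
by rewrite !loc_addE; apply: loc_frac_eq; rewrite /= ?denM ?den1; ring.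
Qed.

Lemma loc_addC : commutative loc_add.
Proof.
elim/loc_fracW=> a s; elim/loc_fracW=> b t.
by rewrite !loc_addE; apply: loc_frac_eq; rewrite /= ?denM ?den1; ring.
Qed.

Lemma loc_add0 : left_id loc_zero loc_add.
Proof.
elim/loc_fracW=> a s.
by rewrite !loc_addE; apply: loc_frac_eq; rewrite /= ?denM ?den1; ring.
Qed.

Lemma loc_addN : left_inverse loc_zero loc_opp loc_add.
Proof.
elim/loc_fracW=> a s.
by rewrite loc_oppE !loc_addE; apply: loc_frac_eq; rewrite /= ?denM ?den1; ring.
Qed.

HB.instance Definition _ := GRing.isZmodule.Build localization
  loc_addA loc_addC loc_add0 loc_addN.

Lemma loc_mulA : associative loc_mul.
Proof.
elim/loc_fracW=> a s; elim/loc_fracW=> b t; elim/loc_fracW=> c u.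
by rewrite !loc_mulE; apply: loc_frac_eq; rewrite /= ?denM ?den1; ring.
Qed.

Lemma loc_mulC : commutative loc_mul.
Proof.
elim/loc_fracW=> a s; elim/loc_fracW=> b t.
by rewrite !loc_mulE; apply: loc_frac_eq; rewrite /= ?denM ?den1; ring.
Qed.

Lemma loc_mul1 : left_id loc_one loc_mul.
Proof.
elim/loc_fracW=> a s.
by rewrite !loc_mulE; apply: loc_frac_eq; rewrite /= ?denM ?den1; ring.
Qed.

Lemma loc_mulDl : left_distributive loc_mul loc_add.
Proof.
elim/loc_fracW=> a s; elim/loc_fracW=> b t; elim/loc_fracW=> c u.
rewrite !(loc_addE, loc_mulE); apply: loc_frac_eq.
by rewrite /= ?denM ?den1; ring.
Qed.

HB.instance Definition _ := GRing.Zmodule_isComPzRing.Build localization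
  loc_mulA loc_mulC loc_mul1 loc_mulDl.

End Localization.

(** * Extended natural numbers *)

(* [None] stands for infinity. *)
Definition enat := option nat.

Definition enat_le (a b : enat) : bool :=
  match a, b with
  | _, None => true
  | None, Some _ => false
  | Some m, Some n => (m <= n)%N
  end.

Definition enat_min (a b : enat) : enat := if enat_le a b then a else b.

Definition enat_sup (Q : set nat) : enat :=
  if `[< has_ubound Q >] then Some (supremum 0%N Q) else None.

(** * Height, depth and Serre's conditions *)

Definition height (S : comPzRingType) (P : prime_ideal S) : enat :=
  enat_sup [set d | exists c : nat -> prime_ideal S,
    c d = P :> set S /\ forall i, (i < d)%N -> (c i : set S) `<` c i.+1].

(* As in EGA, the last quotient R / (r_1, ..., r_m) may vanish. For the depth
   of a local ring this makes no difference, since there the r_i are taken in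
   the maximal ideal. For [complete_intersection I] it only means that the unit
   ideal counts as a complete intersection, by the sequence 1. *)
Definition regular_seq (R : comPzRingType) (rs : seq R) : Prop :=
  forall i, (i < size rs)%N ->
    forall a, ideal_gen [set r | r \in take i rs] (nth 0 rs i * a) ->
              ideal_gen [set r | r \in take i rs] a.

Definition complete_intersection (R : comPzRingType) (I : ideal R) : Prop :=
  exists rs : seq R,
    regular_seq rs /\ (I : set R) = ideal_gen [set r | r \in rs].

(* Meaningful for a local ring, where it is the maximal ideal. *)
Definition nonunits (A : comPzRingType) : set A :=
  [set a | ~ exists b, a * b = 1].

Definition depth (A : comPzRingType) : enat :=
  enat_sup [set d | exists rs : seq A,
    [/\ size rs = d, (forall r, r \in rs -> nonunits r) & regular_seq rs]].

Definition serre (l : nat) (S : comPzRingType) : Prop :=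
  forall P : prime_ideal S,
    enat_le (enat_min (Some l) (height P)) (depth (localization P)).

(** * Cover ideals *)

Section CoverIdeal.
Variables (k : fieldType) (n : nat).

(* The edge set of a graph on ['I_n]. *)
Definition is_graph (G : {set {set 'I_n}}) : Prop :=
  forall C, C \in G -> #|C| = 2%N.

Definition var_ideal (C : {set 'I_n}) : ideal {mpoly k[n]} :=
  ideal_gen [set f | exists2 i, i \in C & f = 'X_i].

Variable G : {set {set 'I_n}}.

Definition cover_set : set {mpoly k[n]} :=
  [set f | forall C, C \in G -> var_ideal C f].

Lemma cover_set0 : cover_set 0.
Proof. by move=> C _; exact: ideal0. Qed.

Lemma cover_setD a b : cover_set a -> cover_set b -> cover_set (a + b).
Proof. by move=> Ia Ib C CG; apply: idealD; [apply: Ia | apply: Ib]. Qed.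

Lemma cover_setM a b : cover_set b -> cover_set (a * b).
Proof. by move=> Ib C CG; apply: idealM; apply: Ib. Qed.

Definition cover_ideal : ideal {mpoly k[n]} :=
  Ideal cover_set0 cover_setD cover_setM.

End CoverIdeal.

(* Main.v *)
Require Import Defs.
From mathcomp Require Import all_boot all_order all_algebra.
From mathcomp Require Import ring zify boolp classical_sets mpoly.

(* Both conditions say that [G] has no edges or is complete bipartite up to
   isolated vertices, i.e. that it contains neither a triangle nor two disjoint
   edges ab, cd with ac, ad, bd not edges.

   Each of these patterns yields monomials f, g in I with x_p f = x_q g locally
   at P_C, where C is the set of its vertices. If I is a complete intersection,
   then I/I^2 is free over R/I, which forces g into P_C I; this is impossible
   by degree. On the other hand the product of the variables of a triangle is
   killed by P_C modulo I^2, so that depth (R/I^2)_{P_C} = 0; and for two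
   disjoint edges P_C -> R/I^2, g + h |-> x_b x_c h for g in P_ab and h in P_cd,
   is not the multiplication by an element, so that the depth is at most 1.

   If G is complete bipartite on A and B, then I = (u, v), where u and v are the
   products of the variables of A and of B, and R/I^2 has a filtration with
   quotients R/(x_a, x_b), a in A, b in B. These are all isomorphic to one
   polynomial ring T over which R has a section common to all the projections
   R -> R/(x_a, x_b) = T (send y_i to x_i - x_{a0},
     resp. x_i - x_{b0}). So regular
   sequences in T are regular on R/I^2. As T is factorial,
     a chain Q0 < Q1 < Q2 of
   its primes gives such a sequence: a prime element modulo Q0 in Q1, and any
   element of Q2 outside Q1. *)

Set Implicit Arguments.
Unset Strict Implicit.
Unset Printing Implicit Defensive.

Import GRing.Theory.
Local Open Scope ring_scope.

(** * Polynomial rings are factorial *)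

Section Factorial.

Definition divides (R : comPzRingType) (a b : R) := exists c, b = c * a.

Lemma dividesD (R : comPzRingType) (a b c : R) :
  divides a b -> divides a c -> divides a (b + c).
Proof. by move=> [u ->] [v ->]; exists (u + v); rewrite mulrDl. Qed.

Lemma dividesMl (R : comPzRingType) (a b c : R) :
  divides a b -> divides a (c * b).
Proof. by move=> [u ->]; exists (c * u); rewrite mulrA. Qed.

Lemma dividesMr (R : comPzRingType) (a b c : R) :
  divides a b -> divides a (b * c).
Proof. by rewrite mulrC; apply: dividesMl. Qed.

(* Units are allowed, so that a unit counts as a factorization of itself. *)
Definition prime_elt (R : idomainType) (p : R) :=
  p != 0 /\ forall a b, divides p (a * b) -> divides p a \/ divides p b.

Definition factorial (R : idomainType) := forall f : R, f != 0 ->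
  exists s : seq R, (forall p, p \in s -> prime_elt p) /\ f = \prod_(p <- s) p.

Lemma factorial_field (K : fieldType) : factorial K.
Proof.
move=> f f0; exists [:: f]; rewrite big_seq1; split=> // p.
rewrite inE => /eqP ->; split=> // a b _; left.
by exists (a / f); rewrite divfK.
Qed.

Lemma factorial_iso (R S : idomainType) (h : {rmorphism R -> S}) (g : S -> R) :
  cancel h g -> cancel g h -> factorial S -> factorial R.
Proof.
move=> hK gK fS f f0.
have hinj := can_inj hK.
have h0 x : (h x == 0) = (x == 0).
  by rewrite -[0](rmorph0 h) (inj_eq hinj).
have [|s [sP e]] := fS (h f); first by rewrite h0.
exists [seq g p | p <- s]; split=> [p /mapP[q /sP[q0 qP] ->]|]; last first.
  apply: hinj; rewrite e big_map rmorph_prod.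
  by apply: eq_bigr => p _; rewrite gK.
split=> [|a b [c e']]; first by rewrite -h0 gK.
have /qP[] : divides q (h a * h b).
  by exists (h c); rewrite -rmorphM e' rmorphM gK.
- move=> [d ed]; left; exists (g d).
  by apply: hinj; rewrite rmorphM !gK.
- move=> [d ed]; right; exists (g d).
  by apply: hinj; rewrite rmorphM !gK.
Qed.

Variable D : idomainType.
Implicit Types (p c : D) (f h q : {poly D}).

Lemma divides_lead p f : divides p%:P f -> divides p (lead_coef f).
Proof. by move=> [q ->]; exists (lead_coef q);
  rewrite lead_coefM lead_coefC. Qed.

Lemma polyBlead_size f : f != 0 ->
  (size (f - lead_coef f *: 'X^((size f).-1))%R < size f)%N.
Proof.
move=> f0; have sf : (0 < size f)%N by rewrite size_poly_gt0.
rewrite -[ltnRHS](prednK sf) ltnS; apply/leq_sizeP => j jf.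
rewrite coefB coefZ coefXn; case: eqP => [->|/eqP jn].
  by rewrite lead_coefE mulr1 subrr.
rewrite mulr0 subr0 nth_default //.
by rewrite -(prednK sf) ltn_neqAle eq_sym jn.
Qed.

Lemma divides_sub_lead p f : divides p (lead_coef f) ->
  divides p%:P (f - lead_coef f *: 'X^((size f).-1)) -> divides p%:P f.
Proof.
move=> [c ec] h; rewrite -[f](subrK (lead_coef f *: 'X^((size f).-1))).
apply: dividesD => //; exists (c *: 'X^((size f).-1)).
by rewrite ec [RHS]mulrC mul_polyC scalerA mulrC.
Qed.

(** Gauss's lemma, by induction on the sum of the sizes: [p] divides the product of the leading
    coefficients, hence one of them, and the corresponding leading term can be stripped off. *)
Lemma prime_polyC p : prime_elt p -> prime_elt p%:P.
Proof.
move=> [p0 pP]; split=> [|f h]; first by rewrite polyC_eq0.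
have [n] := ubnP (size f + size h); elim: n f h => // n IH f h sn e.
have [->|f0] := eqVneq f 0; first by left; exists 0; rewrite mul0r.
have [->|h0] := eqVneq h 0; first by right; exists 0; rewrite mul0r.
have := divides_lead e; rewrite lead_coefM => /pP[] d.
- case: (IH (f - lead_coef f *: 'X^((size f).-1)) h).
  + by rewrite -ltnS; apply: leq_ltn_trans sn; rewrite ltn_add2r polyBlead_size.
  + rewrite mulrBl; apply: dividesD => //; rewrite -mulNr; apply: dividesMr.
    case: d => c ->; exists (- (c *: 'X^((size f).-1))).
    by rewrite mulNr [in RHS]mulrC mul_polyC scalerA [p * _]mulrC.
  + by move=> df; left; apply: divides_sub_lead.
  + by right.
- case: (IH f (h - lead_coef h *: 'X^((size h).-1))).
  + by rewrite -ltnS; apply: leq_ltn_trans sn; rewrite ltn_add2l polyBlead_size.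
  + rewrite mulrBr; apply: dividesD => //; rewrite -mulrN; apply: dividesMl.
    case: d => c ->; exists (- (c *: 'X^((size h).-1))).
    by rewrite mulNr [in RHS]mulrC mul_polyC scalerA [p * _]mulrC.
  + by left.
  + by move=> df; right; apply: divides_sub_lead.
Qed.

(** Turns a factorization over the fraction field into one over [D]: each prime [p] of the scalar
    stays prime as a constant polynomial, so it can be cancelled from [h] or from [q] without
    changing sizes. *)
Lemma cancel_prime_scalars (s : seq D) f h q :
  (forall p, p \in s -> prime_elt p) -> (\prod_(p <- s) p) *: f = h * q ->
  exists h' q', [/\ f = h' * q', size h' = size h & size q' = size q].
Proof.
elim: s h q => [|p s IH] h q sP.
  by rewrite big_nil scale1r => ->; exists h, q.
have pP := sP p (mem_head _ _); have p0 := pP.1.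
rewrite big_cons -scalerA -mul_polyC => e.
have p0' : p%:P != 0 :> {poly D} by rewrite polyC_eq0.
have sP' p' : p' \in s -> prime_elt p' by move=> hp; apply: sP;
  rewrite inE hp orbT.
have szC g : size (g * p%:P) = size g by rewrite mulrC mul_polyC size_scale.
have [||] := (prime_polyC pP).2 h q.
- by exists ((\prod_(j <- s) j) *: f); rewrite -e mulrC.
- move=> [h1 eh]; have [|h' [q' [e1 e2 e3]]] := IH h1 q sP'.
    by apply: (mulfI p0'); rewrite e eh; ring.
  by exists h', q'; rewrite e1 e2 e3 eh szC.
- move=> [q1 eq]; have [|h' [q' [e1 e2 e3]]] := IH h q1 sP'.
    by apply: (mulfI p0'); rewrite e eq; ring.
  by exists h', q'; rewrite e1 e2 e3 eq szC.
Qed.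

(** No gcd of the coefficients is formed: a non-unit prime from the factorization of the leading
    coefficient that divides [f] is pulled out, and each removal shortens the factorization. *)
Lemma primitive_part (s : seq D) f : (forall p, p \in s -> prime_elt p) ->
  lead_coef f = \prod_(p <- s) p -> exists (t : seq D) c h,
  [/\ forall p, p \in t -> prime_elt p, lead_coef h = \prod_(p <- t) p,
      f = c *: h & forall p, p \in t -> divides p%:P h -> divides p 1].
Proof.
have [n] := ubnP (size s); elim: n s f => // n IH s f sn sP e.
have [h|/existsNP[p /not_implyP[ps /not_implyP[[f1 ef] pu]]]] := 
    pselect (forall p, p \in s -> divides p%:P f -> divides p 1).
  by exists s, 1, f; rewrite scale1r.
have p0 := (sP p ps).1.
have sz : (size (rem p s) < n)%N.
  by rewrite size_rem //; case: (s) ps sn.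
have [||t [c [h [tP lt eh tu]]]] := IH (rem p s) f1 sz.
- by move=> q /mem_rem; apply: sP.
- apply: (mulfI p0); rewrite -(big_cons _ _ p (rem p s) xpredT id) /=.
  by rewrite -(perm_big _ (perm_to_rem ps)) /= -e ef lead_coefM lead_coefC
    mulrC.
exists t, (p * c), h; split=> //.
by rewrite ef eh mulrC mul_polyC scalerA.
Qed.

(** Over the fraction field an irreducible polynomial is prime by the gcd; primitivity of [h] brings
    divisibility back to [D]. *)
Lemma primitive_irreducible_prime (t : seq D) h :
  (forall p, p \in t -> prime_elt p) -> lead_coef h = \prod_(p <- t) p ->
  (forall p, p \in t -> divides p%:P h -> divides p 1) ->
  irreducible_poly h -> prime_elt h.
Proof.
move=> tP lt tu [sh irr].
have h0 : h != 0 by rewrite -size_poly_gt0 ltnW.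
(* [%|] is pseudo-divisibility: only a power of [lead_coef h] times [a] is known to be a multiple of
   [h]. One factor of that power is cancelled at a time. *)
have gauss a : h %| a -> divides h a.
  rewrite Pdiv.WeakIdomain.dvdp_eq => /eqP; move: (scalp _ _) (a %/ h) => m q.
  elim: m q => [|m IH] q; first by rewrite expr0 scale1r => ->; exists q.
  rewrite exprS -scalerA.
  have : forall b, lead_coef h *: b = q * h -> exists q', b = q' * h.
    rewrite lt; elim: t tP tu q {lt IH} => [|p t IHt] tP tu q b.
      by rewrite big_nil scale1r => ->; exists q.
    rewrite big_cons -scalerA -mul_polyC => e.
    have pt := mem_head p t.
    have p0 : p%:P != 0 :> {poly D} by rewrite polyC_eq0 (tP p pt).1.
    have tP' p' : p' \in t -> prime_elt p'.
      by move=> hp; apply: tP; rewrite inE hp orbT.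
    have tu' p' : p' \in t -> divides p'%:P h -> divides p' 1.
      by move=> hp; apply: tu; rewrite inE hp orbT.
    (* A prime of [lead_coef h] divides [q], and is cancelled there, or divides [h]; in the second
       case it is a unit, whose inverse is absorbed into [q]. *)
    have [||] := (prime_polyC (tP p pt)).2 q h.
    + by exists ((\prod_(j <- t) j) *: b); rewrite -e mulrC.
    + move=> [q1 eq]; apply: (IHt tP' tu' q1).
      by apply: (mulfI p0); rewrite e eq; ring.
    + move=> /(tu p pt)[p' ep]; apply: (IHt tP' tu' (q * p'%:P)).
      apply: (mulfI p0); rewrite e.
      have -> : p%:P * (q * p'%:P * h) = (p' * p)%:P * (q * h).
        by rewrite polyCM; ring.
      by rewrite -ep mul1r.
  move=> hh e; have [q' e'] := hh _ e; exact: IH e'.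
split=> // a b [c e].
have hab : h %| a * b.
  by apply/Pdiv.Idomain.dvdpP; exists (1, c); rewrite /= ?oner_neq0 ?scale1r.
have [cop|/irr] := boolP (size (gcdp h a) == 1%N).
  by right; apply: gauss; rewrite -(@Gauss_dvdpr _ b a).
move=> /(_ (dvdp_gcdl _ _)) eq; left; apply: gauss.
by rewrite -(eqp_dvdl _ eq) dvdp_gcdr.
Qed.

(** Induction on the size. If [f] is irreducible over the fraction field, its primitive part is
    prime and the rest is a constant; otherwise [f] splits over [D] into two factors of smaller
    size. *)
Lemma factorial_poly : factorial D -> factorial {poly D}.
Proof.
move=> DF f; have [n] := ubnP (size f); elim: n f => // n IH f sn f0.
have constF c : c != 0 -> exists s : seq {poly D},
    (forall p : {poly D}, p \in s -> prime_elt p) /\ c%:P = \prod_(p <- s) p.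
  move=> /DF[t [tP ->]]; exists [seq p%:P | p <- t]; split.
    by move=> _ /mapP[p /tP pP ->]; apply: prime_polyC.
  by rewrite big_map -rmorph_prod.
have [sf|sf] := leqP (size f) 1.
  rewrite (size1_polyC sf); apply: constF.
  by move: f0; rewrite {1}(size1_polyC sf) polyC_eq0.
have [irr|] := pselect (irreducible_poly f).
  have [|s [sP es]] := DF (lead_coef f); first by rewrite lead_coef_eq0.
  have [t [c [h [tP lt ef tu]]]] := primitive_part sP es.
  have c0 : c != 0 by apply: contra_neq f0 => c0; rewrite ef c0 scale0r.
  have hp : prime_elt h.
    apply: primitive_irreducible_prime tP lt tu _.
    have eq : f %= h by rewrite ef eqp_scale.
    split; first by rewrite -(eqp_size eq).
    move=> q sq qh; apply: (eqp_trans (irr.2 q sq _) eq).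
    by rewrite (eqp_dvdr _ eq).
  have [u [uP eu]] := constF c c0; exists (rcons u h); split.
    by move=> p; rewrite mem_rcons inE => /orP[/eqP->//|/uP].
  by rewrite -cats1 big_cat big_seq1 -eu /= mul_polyC.
move=> /not_andP[|/existsNP[q /not_implyP[sq /not_implyP[qf nqf]]]].
  by rewrite sf.
(* Pseudo-divisibility gives [c *: f = d * q]; the prime factors of [c] are then cancelled. *)
have [[c d] /= c0 e] := Pdiv.Idomain.dvdpP _ _ qf.
have [s [sP es]] := DF c c0; rewrite es in e.
have [d' [q' [ef sd sq']]] := cancel_prime_scalars sP e.
have d'0 : d' != 0 by apply: contra_neq f0 => d0; rewrite ef d0 mul0r.
have q'0 : q' != 0 by apply: contra_neq f0 => q0; rewrite ef q0 mulr0.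
have szf : size f = (size d' + size q').-1 by rewrite ef size_mul.
have sq1 : (1 < size q')%N.
  by rewrite sq' ltn_neqAle eq_sym sq -sq' size_poly_gt0.
have sqf : (size q' < size f)%N.
  rewrite ltn_neqAle {2}sq' (dvdp_leq f0 qf) andbT sq'.
  by apply/negP; rewrite dvdp_size_eqp.
have sd1 : (0 < size d')%N by rewrite size_poly_gt0.
have [|s1 [s1P e1]] := IH d' _ d'0.
  rewrite -ltnS (leq_trans _ sn) // szf ltnS -(prednK sd1).
  move: sq1; case: (size q') => [|[|m]] // _.
  by rewrite addSn !addnS /= ltnS leq_addr.
have [|s2 [s2P e2]] := IH q' _ q'0; first exact: leq_trans sqf _.
exists (s1 ++ s2); split; last by rewrite big_cat -e1 -e2.
by move=> p; rewrite mem_cat => /orP[/s1P|/s2P].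
Qed.

End Factorial.


(** * Multivariate polynomials, one variable at a time *)

Lemma mpoly_ring_ind (k : comNzRingType) (n : nat) (P : {mpoly k[n]} -> Prop) :
  (forall c, P c%:MP) -> (forall i, P 'X_i) ->
  (forall f g, P f -> P g -> P (f + g)) ->
  (forall f g, P f -> P g -> P (f * g)) -> forall f, P f.
Proof.
move=> PC PX PD PM; have P1 : P 1 by rewrite -mpolyC1.
elim/mpolyind => [|c m p _ _ Pp]; first by rewrite -mpolyC0.
apply: PD => //; rewrite -mul_mpolyC mpolyXE_id; apply: (PM) => //.
apply: big_ind => [//|f g|i _]; [exact: (PM)|]; elim: (m i) => [|d IH];
  first by rewrite expr0.
by rewrite exprS; apply: PM.
Qed.

Lemma mpoly_rmorph_ext (k : comNzRingType) (n : nat) (S : comNzRingType)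
    (f g : {rmorphism {mpoly k[n]} -> S}) :
  (forall c, f c%:MP = g c%:MP) -> (forall i, f 'X_i = g 'X_i) -> f =1 g.
Proof.
move=> fgC fgX; elim/mpoly_ring_ind => // [p q|p q] ep eq.
  by rewrite !rmorphD ep eq.
by rewrite !rmorphM ep eq.
Qed.

Section MuniIso.
Variables (n : nat) (k : fieldType).
Local Notation widen := (widen_ord (leqnSn n)).

Lemma muni_widen (i : 'I_n) :
  muni ('X_(widen i) : {mpoly k[n.+1]}) = ('X_i)%:P.
Proof.
rewrite muniE msuppX big_seq1 mcoeffX eqxx scale1r.
have -> : [multinom (U_(widen i)%MM (widen j)) | j < n] = U_(i)%MM.
  by apply/mnmP => j; rewrite mnmE !mnm1E.
have -> : U_(widen i)%MM ord_max = 0%N.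
  by rewrite mnm1E -val_eqE /= ltn_eqF.
by rewrite expr0 alg_polyC.
Qed.

Lemma muni_ord_max : muni ('X_ord_max : {mpoly k[n.+1]}) = 'X.
Proof.
rewrite muniE msuppX big_seq1 mcoeffX eqxx scale1r.
have -> : [multinom (U_(ord_max)%MM (widen j)) | j < n] = 0%MM.
  by apply/mnmP => j; rewrite mnmE mnm1E mnm0E -val_eqE /= gtn_eqF.
by rewrite mnm1E eqxx expr1 mpolyX0 scale1r.
Qed.

(** The inverse of [muni]; that the composites are identities is checked on constants and
    variables. *)
Let back : {rmorphism {poly {mpoly k[n]}} -> {mpoly k[n.+1]}} :=
  horner_eval 'X_ord_max \o map_poly (@mwiden n k).

Let backE p : back p = (map_poly (@mwiden n k) p).['X_ord_max].
Proof. by []. Qed.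

Lemma factorial_mpolyS : factorial {mpoly k[n]} -> factorial {mpoly k[n.+1]}.
Proof.
move=> F.
have backC c : back c%:P = mwiden c by rewrite backE map_polyC hornerC.
have backX : back 'X = 'X_ord_max by rewrite backE map_polyX hornerX.
have X_widen i : mwiden ('X_i : {mpoly k[n]}) = 'X_(widen i).
  by rewrite mwidenX mnmwiden1.
have X_case (T : 'I_n.+1 -> Prop) : (forall i, T (widen i)) -> T ord_max ->
    forall i, T i.
  move=> Tw Tm i; case: (unliftP ord_max i) => [j ->|-> //].
  by have -> : lift ord_max j = widen j by apply: val_inj;
    rewrite /= /bump leqNgt ltn_ord.
apply: (@factorial_iso _ _ (@muni n k) back _ _ (factorial_poly F)).
- move=> p; apply: (@mpoly_rmorph_ext _ _ _ (back \o @muni n k) idfun).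
    by move=> c; rewrite /= muniC -mwidenC; apply: backC.
  apply: X_case => [i|] /=.
    by rewrite muni_widen -X_widen; apply: backC.
  by rewrite muni_ord_max; apply: backX.
- move=> p; have muniW (q : {mpoly k[n]}) : muni (mwiden q) = q%:P.
    apply: (@mpoly_rmorph_ext _ _ _ (@muni n k \o @mwiden n k) polyC) =>
      [c|i] /=.
      by rewrite mwidenC muniC.
    by rewrite X_widen muni_widen.
  elim/poly_ind: p => [|p c e]; first by rewrite !rmorph0.
  by rewrite !rmorphD !rmorphM e backX backC /= muniW muni_ord_max.
Qed.

End MuniIso.

Lemma factorial_mpoly (k : fieldType) n : factorial {mpoly k[n]}.
Proof.
elim: n => [|n]; last exact: factorial_mpolyS.
apply: (@factorial_iso _ _ (mcoeff 0%MM : {rmorphism {mpoly k[0]} ->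
  k}) (@mpolyC 0 k)).
- exact: mpolyKC.
- exact: mpolyCK.
- exact: factorial_field.
Qed.

(** * Height, depth and localization *)

Lemma enat_le_trans (a b c : enat) : enat_le a b -> enat_le b c -> enat_le a c.
Proof. by case: a b c => [a|] [b|] [c|] //=; apply: leq_trans. Qed.

Lemma enat_sup_max (Q : set nat) m : Q m -> has_ubound Q ->
  exists2 M, Q M & enat_sup Q = Some M /\ forall d, Q d -> (d <= M)%N.
Proof.
move=> Qm [b ub].
have exQ : exists d, `[< Q d >] by exists m; apply/asboolP.
have ubQ d : `[< Q d >] -> (d <= b)%N by move=> /asboolP /ub.
case: (ex_maxnP exQ ubQ) => M /asboolP QM maxM.
have ubM : ubound Q M by move=> d /asboolP /maxM.
exists M => //; split; last by move=> d /asboolP /maxM.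
rewrite /enat_sup asboolT; last by exists b.
congr Some; rewrite /supremum; case: ifPn => [/eqP Q0|_].
  by move: QM; rewrite Q0.
have [ubS leS] : supremums Q (xget 0%N (supremums Q)).
  by apply: xgetPex; exists M; split=> // d; apply.
by apply/eqP; rewrite eqn_leq; apply/andP; split; [apply: leS | apply: ubS].
Qed.

Lemma enat_sup_ge (Q : set nat) m : Q m -> enat_le (Some m) (enat_sup Q).
Proof.
move=> Qm; have [bQ|nbQ] := pselect (has_ubound Q).
  by have [M QM [-> maxM]] := enat_sup_max Qm bQ; apply: maxM.
by rewrite /enat_sup asboolF.
Qed.

(** A bounded set attains its supremum, and an unbounded one has members beyond any [m]. Bounds on
    heights and depths thus yield actual chains and sequences. *)
Lemma enat_sup_witness (Q : set nat) m : (exists d, Q d) ->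
  enat_le (Some m) (enat_sup Q) -> exists2 d, (m <= d)%N & Q d.
Proof.
move=> [d Qd]; have [bQ|nbQ] := pselect (has_ubound Q).
  by have [M QM [-> maxM]] := enat_sup_max Qd bQ; exists M.
move=> _; apply: contrapT => h; apply: nbQ; exists m => e Qe.
have [//|/ltnW me] := leqP e m; case: h.
by exists e.
Qed.

(** * Regular sequences of length one and two *)

Section RegularPairs.
Variable R : comPzRingType.
Implicit Types (r a b : R) (rs : seq R).

Lemma ideal_gen_mem (X : set R) a : X a -> ideal_gen X a.
Proof.
move=> Xa; exists [:: (1, a)]; rewrite big_seq1 mul1r; split=> // p.
by rewrite inE => /eqP ->.
Qed.

Lemma ideal_gen_sub (X : set R) (I : ideal R) a :
  (forall b, X b -> I b) -> ideal_gen X a -> I a.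
Proof.
move=> XI [s [sX ->]]; elim: s sX => [|p s IH] sX.
  by rewrite big_nil; apply: ideal0.
rewrite big_cons; apply: idealD.
  by apply: idealM; apply: XI; apply: sX; rewrite mem_head.
by apply: IH => q qs; apply: sX; rewrite inE qs orbT.
Qed.

Lemma ideal_gen_nil a : ideal_gen [set r | r \in [::]] a <-> a = 0.
Proof.
split=> [[s [sX ->]]|->]; last exact: ideal0.
by rewrite big1_seq // => p /sX.
Qed.

Lemma ideal_gen_rcons rs r a : ideal_gen [set x | x \in rcons rs r] a <->
  exists b c, ideal_gen [set x | x \in rs] b /\ a = b + c * r.
Proof.
split=> [[s [sX ->]]|[b [c [rsb ->]]]]; last first.
  apply: idealD.
    by apply: ideal_gen_sub rsb => x xs; apply: ideal_gen_mem;
      rewrite /= mem_rcons inE xs orbT.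
  by apply: idealM; apply: ideal_gen_mem; rewrite /= mem_rcons mem_head.
elim: s sX => [|p s IH] sX.
  exists 0, 0; rewrite big_nil mul0r addr0; split=> //; exact: ideal0.
have [|b [c [rsb e]]] := IH; first by move=> q qs; apply: sX;
  rewrite inE qs orbT.
rewrite big_cons e; have := sX p (mem_head _ _);
  rewrite /= mem_rcons inE => /orP[/eqP ->|ps].
  by exists b, (p.1 + c); split=> //; ring.
exists (p.1 * p.2 + b), c; split; last by ring.
exact: (idealD (idealM p.1 (@ideal_gen_mem [set x | x \in rs] _ ps)) rsb).
Qed.

Lemma ideal_gen_seq1 r a : ideal_gen [set x | x \in [:: r]] a <-> divides r a.
Proof.
rewrite -[[:: r]]/(rcons [::] r) ideal_gen_rcons; split.
  by move=> [b [c [/ideal_gen_nil -> ->]]]; exists c; rewrite add0r.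
by move=> [c ->]; exists 0, c; rewrite add0r; split=> //; apply/ideal_gen_nil.
Qed.

Lemma ideal_gen_seq2 r1 r2 a : ideal_gen [set x | x \in [:: r1; r2]] a <->
  exists b c, a = b * r1 + c * r2.
Proof.
rewrite -[[:: r1; r2]]/(rcons [:: r1] r2) ideal_gen_rcons; split.
  by move=> [b [c [/ideal_gen_seq1[d ->] ->]]]; exists d, c.
by move=> [b [c ->]]; exists (b * r1), c; split=> //; apply/ideal_gen_seq1;
  exists b.
Qed.

Definition regular1 r := forall a, r * a = 0 -> a = 0.

Definition regular2 r1 r2 := regular1 r1 /\
  forall a, divides r1 (r2 * a) -> divides r1 a.

Lemma regular_seq1 r : regular_seq [:: r] <-> regular1 r.
Proof.
split=> [h a e|h [|i] //= _ a /ideal_gen_nil/h ->]; last exact: lincomb0.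
by apply/ideal_gen_nil; apply: (h 0%N) => //=; apply/ideal_gen_nil.
Qed.

Lemma regular_seq2 r1 r2 : regular_seq [:: r1; r2] <-> regular2 r1 r2.
Proof.
split=> [h|[h1 h2] [|[|i]] //= _ a].
- split=> a e; first by apply/ideal_gen_nil; apply: (h 0%N) => //=;
    apply/ideal_gen_nil.
  by apply/ideal_gen_seq1; apply: (h 1%N) => //=; apply/ideal_gen_seq1.
- by move=> /ideal_gen_nil/h1 ->; exact: lincomb0.
- by move=> /ideal_gen_seq1/h2 ?; apply/ideal_gen_seq1.
Qed.

Lemma regular_seq_take m rs : regular_seq rs -> regular_seq (take m rs).
Proof.
move=> h i; rewrite size_take_min leq_min => /andP[im irs] a.
by rewrite nth_take // take_takel ?(ltnW im) //; apply: h.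
Qed.

(** The length can be taken to be exactly [m], since initial segments of regular sequences are
    regular. *)
Lemma depth_geP m : enat_le (Some m) (depth R) <-> exists rs : seq R,
  [/\ size rs = m, forall r, r \in rs -> nonunits r & regular_seq rs].
Proof.
split=> [h|[rs h]]; last by apply: enat_sup_ge; exists rs.
have [|d md [rs [sz nu reg]]] := enat_sup_witness _ h.
  by exists 0%N, [::].
exists (take m rs); split; last exact: regular_seq_take.
- by rewrite size_takel // sz.
- by move=> r /mem_take; apply: nu.
Qed.

End RegularPairs.

Section Height.
Variable S : comPzRingType.
Implicit Type P : prime_ideal S.

Definition prime_chain (d : nat) (c : nat -> prime_ideal S) :=
  forall i, (i < d)%N -> proper (c i) (c i.+1).

Lemma height_ge d c P : prime_chain d c -> c d = P ->
  enat_le (Some d) (height P).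
Proof. by move=> hc <-; apply: enat_sup_ge; exists c. Qed.

Lemma height_witness m P : enat_le (Some m) (height P) ->
  exists2 c, prime_chain m c & c m = P :> set S.
Proof.
move=> h; have [|d md [c [cd hc]]] := enat_sup_witness _ h.
  by exists 0%N, (fun=> P).
(* Of a chain of length [d] only the last [m] inclusions are kept, so that it still ends at [P]. *)
exists (fun i => c (d - m + i)%N); last by rewrite subnK.
by move=> i im; rewrite addnS; apply: hc; rewrite -ltn_subRL subKn.
Qed.

End Height.

(** * Depth of a localization, with denominators cleared *)

Section LocalDepth.
Variables (S : comPzRingType) (P : prime_ideal S).
Implicit Types (a b x u v : S) (s t : denom P).

Lemma loc_frac0P a s : loc_frac a s = 0 <-> exists2 u, ~ P u & u * a = 0.
Proof.
rewrite -[0]/(loc_zero P) /loc_zero loc_fracP.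
by split=> -[u Pu]; rewrite den1 mul0r subr0 mulr1 => e; exists u.
Qed.

Lemma denom_of u : ~ P u -> exists s : denom P, den s = u.
Proof.
move=> Pu; have uP : u \notin mem_ideal P by apply/negP => /mem_idealP.
by exists (Sub u uP); rewrite /den SubK.
Qed.

Lemma loc_dividesP a s x t :
  divides (loc_frac a s) (loc_frac x t) <-> exists2 u,
    ~ P u & divides a (u * x).
Proof.
split=> [[y]|[u Pu [c e]]].
  elim/loc_fracW: y => c w.
  rewrite [_ * _](loc_mulE c w a s) => /loc_fracP[u Pu]; rewrite denM => e.
  exists (u * (den w * den s)); first by do !apply: primeNM; rewrite //;
    apply: denomP.
  exists (u * c * den t); apply/eqP; rewrite -subr_eq0; apply/eqP.
  by rewrite -[RHS]e; ring.
have [w ew] := denom_of Pu.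
exists (loc_frac (c * den s) (denomM w t)).
rewrite [_ * _](loc_mulE (c * den s) (denomM w t) a s).
apply: loc_frac_eq; rewrite !denM ew.
have -> : c * den s * a * den t = (c * a) * (den s * den t) by ring.
by rewrite -e; ring.
Qed.

Lemma loc_frac_nonunit a s : nonunits (loc_frac a s) <-> P a.
Proof.
split=> [nu|Pa [y]]; last first.
  elim/loc_fracW: y => c w.
  rewrite [_ * _](loc_mulE a s c w) => /loc_fracP[u Pu]; rewrite denM den1 => e.
  suff /primeM[//|/primeM[/denomP|/denomP]] : P (u * (den s * den w)) by [].
  have -> : u * (den s * den w) = (u * c) * a - u * (a * c * 1 - 1 * (den s *
    den w)).
    by ring.
  by rewrite e subr0; apply: idealM.
apply: contrapT => Pa; apply: nu; have [w ew] := denom_of Pa.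
exists (loc_frac (den s) w); rewrite [_ * _](loc_mulE a s (den s) w).
by apply: loc_frac_eq; rewrite denM den1 ew; ring.
Qed.

Lemma depth_localization_ge1 a : P a -> regular1 a ->
  enat_le (Some 1%N) (depth (localization P)).
Proof.
move=> Pa reg; apply/depth_geP; exists [:: loc_frac a (denom1 P)]; split=> //.
  by move=> r; rewrite inE => /eqP ->; apply/loc_frac_nonunit.
apply/regular_seq1; elim/loc_fracW => x t.
rewrite [_ * _](loc_mulE a (denom1 P) x t) => /loc_frac0P[u Pu e].
by apply/loc_frac0P; exists u => //; apply: reg; rewrite -e; ring.
Qed.

Lemma depth_localization_ge2 a b : P a -> P b -> regular2 a b ->
  enat_le (Some 2%N) (depth (localization P)).
Proof.
move=> Pa Pb [reg1 reg2]; apply/depth_geP.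
exists [:: loc_frac a (denom1 P); loc_frac b (denom1 P)]; split=> //.
  by move=> r; rewrite !inE => /orP[]/eqP ->; apply/loc_frac_nonunit.
apply/regular_seq2; split; elim/loc_fracW => x t.
  rewrite [_ * _](loc_mulE a (denom1 P) x t) => /loc_frac0P[u Pu e].
  by apply/loc_frac0P; exists u => //; apply: reg1; rewrite -e; ring.
rewrite [_ * _](loc_mulE b (denom1 P) x t) => /loc_dividesP[u Pu e].
apply/loc_dividesP; exists u => //; apply: reg2.
by have -> : b * (u * x) = u * (b * x) by ring.
Qed.

(** Regularity of the image of [a] in the localization, expressed in [S]. *)
Definition local_regular1 a :=
  forall x u, ~ P u -> u * (a * x) = 0 -> exists2 v, ~ P v & v * x = 0.

Lemma local_regular1P a s : regular1 (loc_frac a s) -> local_regular1 a.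
Proof.
move=> reg x u Pu e; apply/(loc_frac0P x (denom1 P))/reg.
rewrite [_ * _](loc_mulE a s x (denom1 P)).
by apply/loc_frac0P; exists u.
Qed.

Lemma depth_localization_ge1_inv :
  enat_le (Some 1%N) (depth (localization P)) ->
    exists2 a, P a & local_regular1 a.
Proof.
move=> /depth_geP[rs []]; case: rs => [|r [|]] // _ nu /regular_seq1 reg.
have := nu r (mem_head _ _); elim/loc_fracW: r reg {nu} => a s reg.
by move=> /loc_frac_nonunit Pa; exists a => //; apply: local_regular1P reg.
Qed.

Lemma depth_localization_ge2_inv :
  enat_le (Some 2%N) (depth (localization P)) -> exists a b, [/\ P a, P b,
  local_regular1 a & forall x u, ~ P u -> divides a (u * (b * x)) ->
    exists2 v, ~ P v & divides a (v * x)].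
Proof.
move=> /depth_geP[rs []];
  case: rs => [|r1 [|r2 [|]]] // _ nu /regular_seq2[reg1 reg2].
have := nu r2; have := nu r1; rewrite !inE !eqxx !orbT => /(_ isT) + /(_ isT).
elim/loc_fracW: r1 reg1 reg2 {nu} => a s reg1 reg2 /loc_frac_nonunit Pa.
elim/loc_fracW: r2 reg2 => b t reg2 /loc_frac_nonunit Pb.
exists a, b; split=> //; first exact: local_regular1P reg1.
move=> x u Pu d; apply/(loc_dividesP a s x (denom1 P))/reg2.
rewrite [_ * _](loc_mulE b t x (denom1 P)).
by apply/loc_dividesP; exists u.
Qed.

End LocalDepth.

(** Height at least 1 or 2 provides a chain of that length ending at [P], and sequences regular in
    [S] remain regular after localization. In height 0 the empty sequence is enough. *)
Lemma serre2_suff (S : comPzRingType) :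
  (forall P0 P1 : prime_ideal S, proper P0 P1 ->
    exists2 a, P1 a & regular1 a) ->
  (forall P0 P1 P2 : prime_ideal S, proper P0 P1 -> proper P1 P2 ->
    exists a b, [/\ P2 a, P2 b & regular2 a b]) ->
  serre 2 S.
Proof.
move=> h1 h2 P; have ht m := @height_witness S m P.
have chain1 : enat_le (Some 1%N) (height P) ->
    enat_le (Some 1%N) (depth (localization P)).
  move=> /ht[c /(_ 0%N isT) c01 c1].
  have [a] := h1 _ _ c01; rewrite c1.
  exact: depth_localization_ge1.
have chain2 : enat_le (Some 2%N) (height P) ->
    enat_le (Some 2%N) (depth (localization P)).
  move=> /ht[c hc c2].
  have [a [b]] := h2 _ _ _ (hc 0%N isT) (hc 1%N isT); rewrite c2 => -[].
  exact: depth_localization_ge2.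
move: chain1 chain2; rewrite /enat_min.
case: (height P) => [[|[|m]]|] //= c1 c2; [|exact: c1|exact: c2|exact: c2].
by apply/depth_geP; exists [::].
Qed.

(** The chain bounds the height of [c m] below by [m], and [m <= 2] keeps the minimum with 2 from
    cutting this bound. *)
Lemma serre2_depth (S : comPzRingType) m (c : nat -> prime_ideal S) :
  (m <= 2)%N -> serre 2 S -> prime_chain m c ->
  enat_le (Some m) (depth (localization (c m))).
Proof.
move=> m2 /(_ (c m)) sc hc; apply: enat_le_trans sc.
by have := height_ge hc erefl; rewrite /enat_min; case: ifP.
Qed.

(** * Regular sequences modulo an ideal *)

Lemma ideal_sub (R : comPzRingType) (I : ideal R) a b : I a -> I b -> I (a - b).
Proof. by move=> Ia Ib; apply: idealD => //; apply: idealN. Qed.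

Lemma ideal_mulr (R : comPzRingType) (I : ideal R) a b : I a -> I (a * b).
Proof. by rewrite mulrC; apply: idealM. Qed.

(** * Primes of R/J as primes of R containing J *)

Section QuotientTransfer.
Variables (R : comPzRingType) (J : ideal R).
Implicit Types (a b r : R).

Lemma quot_proj0P a : quot_proj J a = 0 <-> J a.
Proof.
have -> : 0 = quot_proj J 0.
  by apply: (@addIr _ (quot_proj J 0)); rewrite -quot_projD !add0r.
by rewrite quot_projP subr0.
Qed.

Lemma quot_mulE a b : quot_proj J a * quot_proj J b = quot_proj J (a * b).
Proof. exact: quot_projM. Qed.

Lemma quot_divides r a :
  divides (quot_proj J r) (quot_proj J a) <-> exists c, J (a - c * r).
Proof.
split=> [[]|[c Jc]].
  by elim/quot_projW=> c; rewrite quot_mulE => /quot_projP; exists c.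
by exists (quot_proj J c); rewrite quot_mulE; apply/quot_projP.
Qed.

Definition pull_set (P : prime_ideal (quot_ring J)) a := P (quot_proj J a).

Lemma pull_set0 P : pull_set P 0.
Proof. by rewrite /pull_set (proj2 (quot_proj0P 0) (ideal0 J));
  apply: ideal0. Qed.

Lemma pull_setD P a b : pull_set P a -> pull_set P b -> pull_set P (a + b).
Proof. by rewrite /pull_set quot_projD; apply: idealD. Qed.

Lemma pull_setM P a b : pull_set P b -> pull_set P (a * b).
Proof. by rewrite /pull_set -quot_mulE; apply: idealM. Qed.

Lemma pull_set1 P : ~ pull_set P 1.
Proof. exact: prime1. Qed.

Lemma pull_set_prime P a b : pull_set P (a * b) -> pull_set P a \/ pull_set P b.
Proof. by rewrite /pull_set -quot_mulE => /primeM. Qed.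

Definition pull_prime P : prime_ideal R :=
  @PrimeIdeal _ (Ideal (pull_set0 P) (@pull_setD P) (@pull_setM P))
    (@pull_set1 P) (@pull_set_prime P).

Lemma pull_prime_sub P a : J a -> pull_prime P a.
Proof. by move=> /quot_proj0P e; rewrite /= /pull_set e; apply: ideal0. Qed.

Section Push.
Variables (Q : prime_ideal R) (JQ : forall a, J a -> Q a).

Definition push_set (x : quot_ring J) := exists2 a, Q a & x = quot_proj J a.

Lemma push_setP a : push_set (quot_proj J a) <-> Q a.
Proof.
split=> [[b Qb /quot_projP/JQ Qab]|Qa]; last by exists a.
by rewrite -[a](subrK b); apply: idealD.
Qed.

Lemma push_set0 : push_set 0.
Proof. by exists 0; [apply: ideal0 | apply/esym/quot_proj0P/ideal0]. Qed.

Lemma push_setD x y : push_set x -> push_set y -> push_set (x + y).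
Proof.
by move=> [a Qa ->] [b Qb ->]; rewrite -quot_projD; apply/push_setP/idealD.
Qed.

Lemma push_setM x y : push_set y -> push_set (x * y).
Proof.
elim/quot_projW: x => a [b Qb ->]; rewrite quot_mulE.
by apply/push_setP/idealM.
Qed.

Lemma push_set1 : ~ push_set 1.
Proof. by move/push_setP/prime1. Qed.

Lemma push_set_prime x y : push_set (x * y) -> push_set x \/ push_set y.
Proof.
elim/quot_projW: x => a; elim/quot_projW: y => b.
by rewrite quot_mulE !push_setP => /primeM.
Qed.

Definition push_prime : prime_ideal (quot_ring J) :=
  @PrimeIdeal _ (Ideal push_set0 push_setD push_setM) push_set1 push_set_prime.

Lemma push_primeP a : push_prime (quot_proj J a) <-> Q a.
Proof. exact: push_setP. Qed.

End Push.

End QuotientTransfer.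

(** * Regularity along exact sequences of quotients *)

Section ModRegular.
Variable R : comPzRingType.
Implicit Types (J K : ideal R) (a b r w : R).

Definition mod_regular1 J r := forall a, J (r * a) -> J a.

Definition mod_regular2 J r1 r2 := mod_regular1 J r1 /\ forall a,
  (exists c, J (r2 * a - c * r1)) -> exists c, J (a - c * r1).

Lemma quot_regular1 J r : mod_regular1 J r -> regular1 (quot_proj J r).
Proof.
move=> reg; elim/quot_projW=> a; rewrite quot_mulE => /quot_proj0P/reg Ja.
exact/quot_proj0P.
Qed.

Lemma quot_regular2 J r1 r2 :
  mod_regular2 J r1 r2 -> regular2 (quot_proj J r1) (quot_proj J r2).
Proof.
move=> [reg1 reg2]; split; first exact: quot_regular1.
elim/quot_projW=> a; rewrite quot_mulE => /quot_divides/reg2 h.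
exact/quot_divides.
Qed.

(* [0 -> R/K -> R/J -> R/J' -> 0] is exact, by multiplication by [w]. *)
Definition mod_extension J J' K w :=
  [/\ forall a, J a -> J' a, J' w, forall a, J' a -> exists c, J (a - c * w)
    & forall c, J (c * w) <-> K c].

(** Multiplication by [r] is injective on the middle of a short exact sequence as soon as it is so
    on both ends. *)
Lemma mod_regular1_ext J J' K w r : mod_extension J J' K w ->
  mod_regular1 J' r -> mod_regular1 K r -> mod_regular1 J r.
Proof.
move=> [JJ' J'w genw colon] reg' regK a Jra.
have [c Jac] := genw _ (reg' _ (JJ' _ Jra)).
have Kc : K c.
  apply/regK/colon; have -> : r * c * w = r * a - r * (a - c * w) by ring.
  by apply: ideal_sub => //; apply: idealM.
by rewrite -[a](subrK (c * w)); apply: idealD => //; apply/colon.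
Qed.

(** As [r1] is regular on R/J', the sequence stays exact modulo [r1], and the argument for one
    element applies to [r2]. *)
Lemma mod_regular2_ext J J' K w r1 r2 : mod_extension J J' K w ->
  mod_regular2 J' r1 r2 -> mod_regular2 K r1 r2 -> mod_regular2 J r1 r2.
Proof.
move=> ext [reg1' reg2'] [reg1K reg2K]; split.
  exact: mod_regular1_ext ext _ _.
have [JJ' J'w genw colon] := ext => a [d Jd].
have [|e J'e] := reg2' a; first by exists d; apply: JJ'.
have [c Jc] := genw _ J'e.
have Jsum : J (r1 * (r2 * e - d) + r2 * (c * w)).
  have -> : r1 * (r2 * e - d) + r2 * (c * w) =
    (r2 * a - d * r1) - r2 * (a - e * r1 - c * w) by ring.
  by apply: ideal_sub => //; apply: idealM.
(* This is the exactness modulo [r1]: [J'] contains [w], hence [r1 * (r2 * e - d)], and [r1] can be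
   cancelled modulo [J']. *)
have [|c' Jc'] := genw (r2 * e - d).
  apply: reg1'; rewrite -[_ * _](addrK (r2 * (c * w))).
  by apply: ideal_sub; [apply: JJ' | do !apply: idealM].
have [|g Kg] := reg2K c.
  exists (- c'); apply/colon.
  have -> : (r2 * c - - c' * r1) * w = (r1 * (r2 * e - d) + r2 * (c * w))
     - r1 * (r2 * e - d - c' * w) by ring.
  by apply: ideal_sub => //; apply: idealM.
exists (e + g * w).
have -> : a - (e + g * w) * r1 = (a - e * r1 - c * w) + (c - g * r1) * w
  by ring.
by apply: idealD => //; apply/colon.
Qed.

End ModRegular.

(** * Powers of the monomial primes *)

Section Weight.
Variables (k : fieldType) (n : nat).
Implicit Types (C : {set 'I_n}) (f g : {mpoly k[n]}) (m : 'X_{1..n}) (d e :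
  nat).

(** The degree of the monomial in the variables of [C]. *)
Definition weight C m := (\sum_(i in C) m i)%N.

Lemma weightD C m1 m2 : weight C (m1 + m2) = (weight C m1 + weight C m2)%N.
Proof. by rewrite -big_split; apply: eq_bigr => i _; rewrite mnmDE. Qed.

Lemma weight1 C i : weight C U_(i) = (i \in C).
Proof.
rewrite /weight; under eq_bigr do rewrite mnm1E.
have [iC|iC] := boolP (i \in C).
  rewrite (bigD1 i) //= eqxx big1 // => j /andP[_ ji].
  by rewrite eq_sym (negbTE ji).
by rewrite big1 // => j jC; case: eqP => // ij; rewrite ij jC in iC.
Qed.

Definition weight_set C d f := forall m, m \in msupp f -> (d <= weight C m)%N.

Lemma weight_set0 C d : weight_set C d 0.
Proof. by move=> m; rewrite msupp0. Qed.

Lemma weight_setD C d f g :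
  weight_set C d f -> weight_set C d g -> weight_set C d (f + g).
Proof.
by move=> hf hg m /msuppD_le; rewrite mem_cat => /orP[/hf|/hg].
Qed.

Lemma weight_setMM C d e f g :
  weight_set C d f -> weight_set C e g -> weight_set C (d + e) (f * g).
Proof.
move=> hf hg _ /msuppM_le/allpairsP[[m1 m2] [/= /hf h1 /hg h2 ->]].
by rewrite weightD leq_add.
Qed.

Lemma weight_setM C d f g : weight_set C d g -> weight_set C d (f * g).
Proof. by move=> hg; rewrite -[d]add0n; apply: weight_setMM. Qed.

(* The [d]-th power of [var_ideal C], in terms of monomials. *)
Definition weight_ideal C d : ideal {mpoly k[n]} :=
  Ideal (@weight_set0 C d) (@weight_setD C d) (@weight_setM C d).

Lemma weight_idealX C d m : weight_ideal C d 'X_[m] <-> (d <= weight C m)%N.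
Proof.
split=> [|dm m']; first by apply; rewrite msuppX mem_head.
by rewrite msuppX inE => /eqP ->.
Qed.

Lemma weight_idealXU C i : weight_ideal C 1 'X_i <-> i \in C.
Proof. by rewrite weight_idealX weight1; case: (i \in C). Qed.

Lemma weight_ideal_mul C d e (I J : ideal {mpoly k[n]}) f :
  (forall g, I g -> weight_ideal C d g) -> (forall g, J g ->
    weight_ideal C e g) ->
  ideal_mul I J f -> weight_ideal C (d + e) f.
Proof.
move=> Id Je; apply: ideal_gen_sub => _ [a [b [/Id Ia /Je Jb ->]]].
exact: weight_setMM.
Qed.

Lemma weight_le C d e f : (d <= e)%N -> weight_ideal C e f ->
  weight_ideal C d f.
Proof. by move=> de h m /h; apply: leq_trans. Qed.

Lemma weight_subset (C D : {set 'I_n}) d f : C \subset D ->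
  weight_ideal C d f -> weight_ideal D d f.
Proof.
move=> CD h m /h /leq_trans; apply.
rewrite /weight [leqRHS](big_setID C) (finset.setIidPr CD).
exact: leq_addr.
Qed.

(** A monomial of positive weight is divisible by some variable of [C]. *)
Lemma var_idealP C f : var_ideal k C f <-> weight_ideal C 1 f.
Proof.
split; first by apply: ideal_gen_sub => _ [i iC ->]; apply/weight_idealXU.
move=> h; rewrite [f]mpolyE big_seq.
apply: big_ind => [||m /h]; [exact: ideal0|exact: idealD|].
rewrite lt0n sum_nat_eq0 => /forallPn[i]; rewrite negb_imply => /andP[iC mi].
rewrite -mul_mpolyC; apply: idealM.
have /submK <- : (U_(i) <= m)%MM by rewrite lep1mP.
by rewrite mpolyXD; apply: idealM; apply: ideal_gen_mem; exists i.
Qed.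

Section Grading.
Variable C : {set 'I_n}.

(* Powers of the new variable separate the components of different weight. *)
Let phi : {mpoly k[n]} -> {poly {mpoly k[n]}} :=
  mmap (polyC \o @mpolyC n k) (fun i => 'X^(i \in C) * ('X_i)%:P).

Let phiM f g : phi (f * g) = phi f * phi g.
Proof. exact: rmorphM. Qed.

Let phiX m : phi 'X_[m] = 'X^(weight C m) * ('X_[m])%:P.
Proof.
rewrite /phi mmapX /mmap1 mpolyXE_id rmorph_prod /weight [in RHS]big_mkcond /=.
rewrite -prodrXr -big_split; apply: eq_bigr => i _ /=.
rewrite exprMn rmorphXn -exprM; congr (_ * _).
by case: (i \in C); rewrite ?mul1n ?mul0n.
Qed.

Let phiD f g : phi (f + g) = phi f + phi g.
Proof. exact: mmapD. Qed.

Let phiZ c f : phi (c *: f) = (c%:MP)%:P * phi f.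
Proof. exact: mmapZ. Qed.

Let phi_coef f d m : (phi f)`_d@_m = if weight C m == d then f@_m else 0.
Proof.
elim/mpolyind: f => [|c m' p _ _ e].
  by rewrite [phi 0]mmap0 coef0 mcoeff0; case: ifP.
rewrite phiD phiZ coefD !mcoeffD e phiX coefCM coefMC coefXn mcoeffZ mcoeffCM.
rewrite mcoeffX mulr_natl mcoeffMn mcoeffX [d == _]eq_sym.
case: (eqVneq m' m) => [->|_]; last by rewrite mul0rn mulr0 !add0r.
by case: eqP; rewrite ?mulr0 ?add0r.
Qed.

Let weight_phi d f : weight_ideal C d f <-> forall i, (i < d)%N ->
  (phi f)`_i = 0.
Proof.
split=> [h i id|h m]; last first.
  rewrite mcoeff_msupp leqNgt => fm; apply/negP => /h /(congr1 (mcoeff m)).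
  by rewrite phi_coef eqxx mcoeff0; apply/eqP.
apply/mpolyP => m; rewrite phi_coef mcoeff0; case: eqP => // mi.
apply/eqP; rewrite mcoeff_eq0; apply: contraTN id => /h.
by rewrite mi leqNgt.
Qed.

(** All that is needed of the grading: a multiplicative map under which order along [P_C] becomes
    order in one new variable. *)
Lemma weight_grading : exists2 psi : {mpoly k[n]} -> {poly {mpoly k[n]}},
  forall f g, psi (f * g) = psi f * psi g &
  forall d f, weight_ideal C d f <-> forall i, (i < d)%N -> (psi f)`_i = 0.
Proof. by exists phi. Qed.

End Grading.

(** The powers of [P_C] are [P_C]-primary. The constant coefficient of [phi f] is nonzero, so in a
    domain the low coefficients of [phi g] vanish one after the other. *)
Lemma weight_idealM_cancel C d f g : ~ weight_ideal C 1 f ->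
  weight_ideal C d (f * g) -> weight_ideal C d g.
Proof.
have [phi phiM weight_phi] := weight_grading C.
move=> nf; rewrite !weight_phi => hfg.
have f0 : (phi f)`_0 != 0.
  by apply/eqP => f0; apply: nf; apply/weight_phi => -[|].
elim/ltn_ind => i IH id; have := hfg i id.
rewrite phiM coefM big_ord_recl big1 ?addr0 => [|j _]; last first.
  have ji : (i - lift ord0 j < i)%N.
    by rewrite lift0 ltn_subrL (leq_ltn_trans (leq0n j) (ltn_ord j)).
  by rewrite (IH _ ji (ltn_trans ji id)) mulr0.
by rewrite subn0 => /eqP; rewrite mulf_eq0 (negbTE f0) => /eqP.
Qed.


Lemma weight_ideal1_neq1 C : ~ weight_ideal C 1 1.
Proof.
by move=> /(_ 0%MM); rewrite msupp1 mem_head => /(_ isT);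
  rewrite /weight big1 // => i _; rewrite mnm0E.
Qed.

Lemma weight_ideal1_prime C f g :
  weight_ideal C 1 (f * g) -> weight_ideal C 1 f \/ weight_ideal C 1 g.
Proof.
have [|/weight_idealM_cancel nf /nf] := pselect (weight_ideal C 1 f);
  by [left | right].
Qed.

Definition var_prime C : prime_ideal {mpoly k[n]} :=
  PrimeIdeal (@weight_ideal1_neq1 C) (@weight_ideal1_prime C).

(** A unit at [P_C] that lies in [P_E] for every edge [E] not contained in [C]; multiplying by it
    reduces membership in the cover ideal to the edges inside [C]. *)
Definition outer_vars C : {mpoly k[n]} := \prod_(i | i \notin C) 'X_i.

Lemma outer_vars_notin C : ~ weight_ideal C 1 (outer_vars C).
Proof.
apply: (big_ind (fun f => ~ weight_ideal C 1 f)).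
- exact: weight_ideal1_neq1.
- by move=> f g nf ng /weight_ideal1_prime[].
- by move=> i iC /weight_idealXU; apply/negP.
Qed.

Lemma outer_vars_in C i : i \notin C -> divides 'X_i (outer_vars C).
Proof.
by move=> iC; rewrite /outer_vars (bigD1 i) //= mulrC; eexists.
Qed.

End Weight.

Arguments weight_idealM_cancel {k n C d f g} _ _.
Arguments weight_ideal_mul {k n C d e I J f} _ _ _.

(** * Forbidden subgraphs *)

Section Syzygies.
Variable R : comPzRingType.
Implicit Types (rs : seq R) (I K : ideal R).

Lemma ideal_gen_seqP rs f : ideal_gen [set r | r \in rs] f <->
  exists a : nat -> R, f = \sum_(i < size rs) a i * nth 0 rs i.
Proof.
split=> [|[a ->]]; last first.
  apply: big_ind => [||i _]; [exact: ideal0|exact: idealD|].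
  by apply: idealM; apply: ideal_gen_mem; apply: mem_nth.
elim/last_ind: rs f => [|rs r IH] f.
  by move=> /ideal_gen_nil ->; exists (fun=> 0); rewrite big_ord0.
move=> /ideal_gen_rcons[b [c [/IH[a ->] ->]]].
exists (fun i => if (i < size rs)%N then a i else c).
rewrite size_rcons big_ord_recr /= ltnn nth_rcons ltnn eqxx; congr (_ + _).
by apply: eq_bigr => i _; rewrite nth_rcons ltn_ord.
Qed.

(** By regularity the last coefficient lies in the ideal of the previous elements; correcting the
    other coefficients by a Koszul relation leaves a relation of shorter length. *)
Lemma regular_seq_syzygy rs (a : nat -> R) : regular_seq rs ->
  \sum_(i < size rs) a i * nth 0 rs i = 0 ->
  forall i, (i < size rs)%N -> ideal_gen [set r | r \in rs] (a i).
Proof.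
elim/last_ind: rs a => // rs r IH a reg.
have sub f : ideal_gen [set r | r \in rs] f ->
    ideal_gen [set x | x \in rcons rs r] f.
  apply: ideal_gen_sub => x xs; apply: ideal_gen_mem.
  by rewrite /= mem_rcons inE xs orbT.
have rI : ideal_gen [set x | x \in rcons rs r] r.
  by apply: ideal_gen_mem; rewrite /= mem_rcons mem_head.
rewrite size_rcons big_ord_recr /= nth_rcons ltnn eqxx.
under eq_bigr => i _ do rewrite nth_rcons ltn_ord.
move=> e.
have am : ideal_gen [set r | r \in rs] (a (size rs)).
  have := @reg (size rs); rewrite size_rcons ltnSn nth_rcons ltnn eqxx.
  rewrite -cats1 take_size_cat // => /(_ isT); apply.
  apply/ideal_gen_seqP; exists (fun i => - a i).
  under eq_bigr do rewrite mulNr.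
  by rewrite sumrN; apply/eqP; rewrite -addr_eq0 addrC mulrC e.
have regrs : regular_seq rs.
  by rewrite -[rs](take_size_cat [:: r] erefl) cats1; apply: regular_seq_take.
have [b eb] := (ideal_gen_seqP rs _).1 am.
have e' : \sum_(i < size rs) (a i + r * b i) * nth 0 rs i = 0.
  rewrite -[RHS]e eb mulrC mulr_sumr -big_split.
  by apply: eq_bigr => i _ /=; ring.
move=> i; rewrite ltnS leq_eqVlt => /orP[/eqP ->|im]; first exact: sub.
rewrite -[a i](addrK (r * b i)).
apply: (@ideal_sub _ (ideal_gen _)); last exact: ideal_mulr.
exact: sub (IH (fun i => a i + r * b i) regrs e' i im).
Qed.

(* [I/I^2] is free over [R/I], so the coordinates [a], [b] of [f], [g]
   satisfy [x a = y b] modulo [I]. *)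
Lemma complete_intersection_syzygy I K f g x y : complete_intersection I ->
  I f -> I g -> x * f = y * g -> (forall a b, I (x * a - y * b) -> K b) ->
  ideal_mul K I g.
Proof.
move=> [rs [reg eI]].
have IE h : I h <-> ideal_gen [set r | r \in rs] h
  by rewrite -[I h]/((I : set R) h) eI.
move=> /IE/ideal_gen_seqP[a ef] /IE/ideal_gen_seqP[b eg] e colon.
rewrite eg; apply: big_ind => [||i _]; [exact: ideal0|exact: idealD|].
apply: ideal_gen_mem; exists (b i), (nth 0 rs i); split=> //; last first.
  by apply/IE; apply: ideal_gen_mem; apply: mem_nth.
apply: (colon (a i)); apply/IE.
apply: (@regular_seq_syzygy rs (fun i => x * a i - y * b i)) => //.
under eq_bigr do rewrite mulrBl -!mulrA.
by rewrite sumrB -!mulr_sumr -ef -eg e subrr.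
Qed.

End Syzygies.

Lemma weight_set2 n (a b : 'I_n) (m : 'X_{1..n}) : a != b ->
  weight [set a; b] m = (m a + m b)%N.
Proof. by move=> ab; rewrite /weight big_setU1 ?inE // finset.big_set1. Qed.

(** * Cover ideals and their squares near a set of vertices *)

Section CoverSquare.
Variables (k : fieldType) (n : nat) (G : {set {set 'I_n}}).
Hypothesis hG : is_graph G.
Implicit Types (a b c d p q : 'I_n) (C E : {set 'I_n}).
Local Notation I := (cover_ideal k G).

Lemma edge_neq a b : [set a; b] \in G -> a != b.
Proof. by move=> /hG; rewrite cards2; case: (a != b). Qed.

Lemma edgeC a b : ([set a; b] \in G) = ([set b; a] \in G).
Proof. by rewrite finset.setUC. Qed.

Lemma cover_ideal_weight E f : E \in G -> I f -> weight_ideal k E 1 f.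
Proof. by move=> EG /(_ E EG)/var_idealP. Qed.

Lemma cover_square_weight E f : E \in G -> ideal_mul I I f ->
  weight_ideal k E 2 f.
Proof.
by move=> EG; apply: (@weight_ideal_mul _ _ _ 1 1) => g;
  apply: cover_ideal_weight.
Qed.

(** An edge not inside [C] is covered by [outer_vars], and an edge inside [C] avoiding [p] and [q]
    could only be [[set a; b]]. *)
Lemma cover_ideal_pair C p q a b : C \subset [set p; q; a; b] ->
  [set a; b] \notin G -> I ('X_p * 'X_q * outer_vars k C).
Proof.
move=> CS abG E EG; apply/var_idealP.
have [EC|/subsetPn[i iE iC]] := boolP (E \subset C); last first.
  have [r ->] := outer_vars_in k iC; rewrite mulrA; apply: idealM.
  exact/weight_idealXU.
have [pE|pE] := boolP (p \in E).
  by apply: ideal_mulr; apply: ideal_mulr; apply/weight_idealXU.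
have [qE|qE] := boolP (q \in E).
  by apply: ideal_mulr; apply: idealM; apply/weight_idealXU.
case/negP: abG; suff <- : E = [set a; b] by [].
apply/eqP; rewrite finset.eqEcard (hG EG) cards2 ltnS leq_b1 andbT.
apply/fintype.subsetP => i iE;
  move: (fintype.subsetP CS _ (fintype.subsetP EC _ iE)).
rewrite !inE -!orbA => /or4P[] /eqP ii; rewrite ?ii ?eqxx ?orbT //.
  by rewrite -ii iE in pE.
by rewrite -ii iE in qE.
Qed.

Section LinearSyzygy.
Variables (C E : {set 'I_n}) (p q s : 'I_n).

(** With f = x_q x_s w and g = x_p x_s w one has x_p f = x_q g. If x_p a - x_q b lies in I, hence in
    P_E, then b lies in P_{E+p}, as q is outside E+p. So g lies in P_C I. *)
Lemma complete_intersection_no_linear_syzygy : complete_intersection I ->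
  (forall f, I f -> weight_ideal k C 2 f) -> E \in G -> E \subset C ->
    p \in C ->
  q \notin E -> q != p -> I ('X_q * 'X_s * outer_vars k C) ->
  I ('X_p * 'X_s * outer_vars k C) -> False.
Proof.
move=> CI I2 EG EC pC qE qp If Ig.
have pEC : p |: E \subset C by apply/fintype.subsetP => i;
  rewrite !inE => /orP[/eqP->//|/(fintype.subsetP EC)].
have h : ideal_mul (weight_ideal k C 1) I ('X_p * 'X_s * outer_vars k C).
  apply: (complete_intersection_syzygy (x := 'X_p) (y := 'X_q) CI If Ig) =>
    [|a b /(cover_ideal_weight EG) Iab]; first by ring.
  have {}Iab := weight_subset (finset.subsetUr [set p] E) Iab.
  apply: weight_subset pEC _.
  have : weight_ideal k (p |: E) 1 ('X_q * b).
    rewrite -['X_q * b](subKr ('X_p * a)); apply: ideal_sub => //.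
    by apply: ideal_mulr; apply/weight_idealXU; rewrite !inE eqxx.
  apply: weight_idealM_cancel => /weight_idealXU.
  by rewrite !inE (negbTE qp) (negbTE qE).
have id1 g : weight_ideal k C 1 g -> weight_ideal k C 1 g by [].
(* Elements of P_C I have order at least 3 along [P_C], whereas x_p x_s has degree at most 2. *)
have {h} : weight_ideal k C (1 + 2) _ := weight_ideal_mul id1 I2 h.
rewrite mulrC => /(weight_idealM_cancel (@outer_vars_notin k n C)).
rewrite -mpolyXD weight_idealX weightD !weight1.
by case: (_ \in _); case: (_ \in _).
Qed.

End LinearSyzygy.

Definition triangle a b c :=
  [&& [set a; b] \in G, [set b; c] \in G & [set a; c] \in G].

(* An induced matching [ab, cd] or an induced path [a - b - c - d]. *)
Definition split_pair a b c d :=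
  [&& uniq [:: a; b; c; d], [set a; b] \in G, [set c; d] \in G,
      [set a; c] \notin G, [set a; d] \notin G & [set b; d] \notin G].

Lemma loop_notin a : [set a; a] \notin G.
Proof. by apply/negP => /edge_neq; rewrite eqxx. Qed.

Lemma cover_square_sub E C : E \in G -> E \subset C ->
  forall f, ideal_mul I I f -> var_prime k C f.
Proof.
move=> EG EC f /(cover_square_weight EG) h.
by apply: (@weight_le _ _ _ 1 2) => //; apply: weight_subset h.
Qed.

(** Strictness is witnessed by a variable of the larger set. *)
Lemma push_var_chain m (J : ideal {mpoly k[n]}) (D : nat -> {set 'I_n})
    (JD : forall i f, J f -> var_prime k (D i) f) :
  (forall i, (i < m)%N -> D i \proper D i.+1) ->
  prime_chain m (fun i => push_prime (JD i)).
Proof.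
move=> hD i /hD /properP[sD [x xD nxD]]; split=> [y|].
  elim/quot_projW: y => f /push_primeP h; apply/push_primeP.
  exact: weight_subset h.
move=> /(_ (quot_proj J 'X_x)) h; move/negP: nxD; apply.
apply/(@weight_idealXU k)/(push_primeP (JD i))/h/push_primeP.
exact/weight_idealXU.
Qed.

(** * Triangles exclude both conditions *)

Section Triangle.
Variables a b c : 'I_n.
Hypothesis tri : triangle a b c.
Let C := [set a; b; c].

Let abG : [set a; b] \in G. Proof. by case/and3P: tri. Qed.
Let bcG : [set b; c] \in G. Proof. by case/and3P: tri. Qed.
Let acG : [set a; c] \in G. Proof. by case/and3P: tri. Qed.

Lemma triangle_cover :
  [/\ I ('X_a * 'X_b * outer_vars k C), I ('X_b * 'X_c * outer_vars k C)
    & I ('X_a * 'X_c * outer_vars k C)].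
Proof.
(* The excluded pair is degenerate here: a singleton is never an edge. *)
split; [apply: (cover_ideal_pair _ (loop_notin c))|
  apply: (cover_ideal_pair _ (loop_notin a))|
  apply: (cover_ideal_pair _ (loop_notin b))];
  by apply/fintype.subsetP => i; rewrite !inE => /orP[/orP[]|] ->;
    rewrite ?orbT.
Qed.

(** Adding the inequalities of the three edges, twice the weight is at least 3. *)
Lemma triangle_weight f : I f -> weight_ideal k C 2 f.
Proof.
move=> If m mf.
have := cover_ideal_weight abG If mf; have := cover_ideal_weight bcG If mf.
have := cover_ideal_weight acG If mf.
rewrite !weight_set2 ?edge_neq //.
have -> : weight C m = (m a + m b + m c)%N.
  rewrite /C finset.setUC /weight big_setU1 /=; last first.
    by rewrite !inE ![c == _]eq_sym (negbTE (edge_neq acG)) (negbTE (edge_neq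
      bcG)).
  by rewrite -/(weight _ m) weight_set2 ?edge_neq // addnC.
lia.
Qed.

Lemma triangle_not_complete_intersection : complete_intersection I -> False.
Proof.
move=> CI; have [Xab Xbc Xac] := triangle_cover.
apply: (@complete_intersection_no_linear_syzygy C [set b; c] b a c CI) => //.
- exact: triangle_weight.
- by apply/fintype.subsetP => i; rewrite !inE => /orP[] ->; rewrite ?orbT.
- by rewrite !inE eqxx orbT.
- by rewrite !inE negb_or !edge_neq.
- exact: edge_neq.
Qed.


(** Shows x_a x_b x_c w^2 to be killed by [P_C] modulo I^2: its product with x_a, for instance, is
    (x_a x_b w)(x_a x_c w). *)
Lemma triangle_square f : weight_ideal k C 1 f ->
  ideal_mul I I (f * ('X_a * 'X_b * 'X_c * outer_vars k C ^+ 2)).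
Proof.
have [Xab Xbc Xac] := triangle_cover; set w := outer_vars k C in Xab Xbc Xac *.
have II g h e : I g -> I h -> e = g * h -> ideal_mul I I e.
  by move=> Ig Ih ->; apply: ideal_gen_mem; exists g, h.
move=> /var_idealP[s [sC ->]]; rewrite mulr_suml big_seq.
apply: big_ind => [||p /sC[i iC ei]]; [exact: ideal0|exact: idealD|].
rewrite ei -(mulrA p.1); apply: idealM; move: iC;
  rewrite !inE => /orP[/orP[]|] /eqP ->.
- by apply: (II _ _ _ Xab Xac); ring.
- by apply: (II _ _ _ Xab Xbc); ring.
- by apply: (II _ _ _ Xac Xbc); ring.
Qed.

Lemma triangle_not_serre2 : serre 2 (quot_ring (ideal_mul I I)) -> False.
Proof.
have [Xab Xbc Xac] := triangle_cover; set w := outer_vars k C in Xab Xbc Xac.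
(* The primes P_ab < P_abc contain I^2, so the depth at P_abc would be at least 1. *)
pose D (i : nat) := if i is 0 then [set a; b] else C.
have abD i : [set a; b] \subset D i by case: i => [|i];
  rewrite ?finset.subsetUl.
have JD i := cover_square_sub abG (abD i).
move=> S2; have : enat_le (Some 1%N) (depth (localization (push_prime (JD
  1%N)))).
  apply: (serre2_depth (c := fun i => push_prime (JD i))) => //.
  apply: push_var_chain => -[|//] _; apply/properP; split;
    first exact: finset.subsetUl.
  exists c; first by rewrite !inE eqxx orbT.
  by rewrite !inE negb_or ![c == _]eq_sym !edge_neq.
move=> /depth_localization_ge1_inv[x].
elim/quot_projW: x => f /push_primeP Cf reg.
(* The regular element [f] of [P_C] kills x_a x_b x_c w^2, which would then vanish locally. But I^2
   has order at least 4 along [P_C], and this product has order 3. *)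
have [||v] := reg (quot_proj _ ('X_a * 'X_b * 'X_c * w ^+ 2)) 1.
- exact: prime1.
- by rewrite mul1r quot_mulE; apply/quot_proj0P/triangle_square.
elim/quot_projW: v => v nv; rewrite quot_mulE => /quot_proj0P Jv.
have {}nv : ~ weight_ideal k C 1 v by move=> Cv; apply: nv; apply/push_primeP.
have : weight_ideal k C (2 + 2) _ :=
  weight_ideal_mul triangle_weight triangle_weight Jv.
have nw : ~ weight_ideal k C 1 w by apply: outer_vars_notin.
move=> /(weight_idealM_cancel nv).
have -> : 'X_a * 'X_b * 'X_c * w ^+ 2 = w * (w * ('X_a * 'X_b * 'X_c)) by ring.
move=> /(weight_idealM_cancel nw)/(weight_idealM_cancel nw).
rewrite -!mpolyXD weight_idealX !weightD !weight1.
by do 3!case: (_ \in _).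
Qed.

End Triangle.

(** * Split pairs exclude both conditions *)

Section SplitPair.
Variables a b c d : 'I_n.
Hypothesis sp : split_pair a b c d.
Let C := [set a; b; c; d].
Let w := outer_vars k C.

Let uniqC : uniq [:: a; b; c; d]. Proof. by case/andP: sp. Qed.
Let abG : [set a; b] \in G. Proof. by case/and3P: sp. Qed.
Let cdG : [set c; d] \in G. Proof. by case/and4P: sp. Qed.

Lemma split_pair_cover :
  [/\ I ('X_a * 'X_c * w), I ('X_b * 'X_c * w) & I ('X_b * 'X_d * w)].
Proof.
case/and5P: sp => _ _ _ acG /andP[adG bdG].
split; [apply: (cover_ideal_pair _ bdG)|apply: (cover_ideal_pair _ adG)|
  apply: (cover_ideal_pair _ acG)];
  by apply/fintype.subsetP => i; rewrite !inE -!orbA => /or4P[] ->;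
    rewrite ?orbT.
Qed.

Let neqs : [/\ a != b, a != c, a != d & [/\ b != c, b != d & c != d]].
Proof.
move: uniqC; rewrite /= !inE !negb_or -!andbA andbT.
by move=> /and5P[-> -> -> -> /andP[-> ->]].
Qed.

(** The two disjoint edges contribute at least 1 each. *)
Lemma split_pair_weight f : I f -> weight_ideal k C 2 f.
Proof.
move=> If m mf.
have := cover_ideal_weight abG If mf; have := cover_ideal_weight cdG If mf.
have [ab ac ad [bc bd cd]] := neqs.
have -> : C = [set a; b] :|: [set c; d] by rewrite /C finset.setUA.
rewrite /weight (eq_bigl _ _ (fun i => finset.in_setU i [set a; b] [set c;
  d])) bigU /=; last first.
  rewrite -finset.setI_eq0; apply/eqP/finset.setP => i; rewrite !inE;
    apply/negP.
   by case/andP=> /orP[] /eqP ei /orP[] /eqP ej; move: ac ad bc bd;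
     rewrite -ei -ej !eqxx.
by move=> h1 h2; apply: (leq_add h2 h1).
Qed.

Lemma split_pair_not_complete_intersection : complete_intersection I -> False.
Proof.
move=> CI; have [Xac Xbc Xbd] := split_pair_cover.
have [ab ac ad [bc bd cd]] := neqs.
apply: (@complete_intersection_no_linear_syzygy C [set c; d] b a c CI) => //.
- exact: split_pair_weight.
- by apply/fintype.subsetP => i; rewrite !inE => /orP[] ->; rewrite ?orbT.
- by rewrite !inE eqxx !orbT.
- by rewrite !inE negb_or ac.
Qed.

(** On generators, x_i x_j x_b x_c regroups into two of the products x_a x_c, x_b x_c, x_b x_d, for
    i in ab and j in cd. *)
Lemma split_pair_square f g :
  weight_ideal k [set a; b] 1 f -> weight_ideal k [set c; d] 1 g ->
  ideal_mul I I (f * g * ('X_b * 'X_c * w ^+ 2)).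
Proof.
have [Xac Xbc Xbd] := split_pair_cover.
have II g1 g2 e : I g1 -> I g2 -> e = g1 * g2 -> ideal_mul I I e.
  by move=> I1 I2 ->; apply: ideal_gen_mem; exists g1, g2.
move=> /var_idealP[s [sC ->]] /var_idealP[t [tC ->]].
rewrite mulr_suml mulr_suml big_seq.
apply: big_ind => [||p /sC[i iC ei]]; [exact: ideal0|exact: idealD|].
rewrite mulr_sumr mulr_suml big_seq.
apply: big_ind => [||q /tC[j jC ej]]; [exact: ideal0|exact: idealD|].
have -> : p.1 * p.2 * (q.1 * q.2) * ('X_b * 'X_c * w ^+ 2) =
  p.1 * q.1 * ('X_i * 'X_j * ('X_b * 'X_c * w ^+ 2)) by rewrite ei ej; ring.
apply: idealM; move: iC jC; rewrite !inE => /orP[]/eqP -> /orP[]/eqP ->.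
- by apply: (II _ _ _ Xac Xbc); ring.
- by apply: (II _ _ _ Xac Xbd); ring.
- by apply: (II _ _ _ Xbc Xbc); ring.
- by apply: (II _ _ _ Xbc Xbd); ring.
Qed.

Lemma split_pair_decomp f : weight_ideal k C 1 f -> exists g h,
  [/\ weight_ideal k [set a; b] 1 g, weight_ideal k [set c; d] 1 h & f = g + h].
Proof.
move=> /var_idealP[s [sC ->]]; elim: s sC => [|p s IH] sC.
  by exists 0, 0; rewrite big_nil add0r; split=> //; apply: ideal0.
have [|g [h [gab hcd e]]] := IH; first by move=> q qs; apply: sC;
  rewrite inE qs orbT.
rewrite big_cons e; have [i] := sC p (mem_head _ _).
rewrite !inE -!orbA orbA => /orP[] iC ei.
  exists (p.1 * p.2 + g), h; rewrite addrA; split=> //.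
  apply: idealD => //; apply: idealM; rewrite ei; apply/weight_idealXU.
  by rewrite !inE.
exists g, (p.1 * p.2 + h); rewrite addrCA; split=> //.
apply: idealD => //; apply: idealM; rewrite ei; apply/weight_idealXU.
by rewrite !inE.
Qed.

(* The map [g + h |-> X_b X_c h w^2] on [P_C = P_ab + P_cd] is well defined
   modulo [I^2]. Depth 2 would make it the multiplication by a fraction. *)
Lemma split_pair_not_serre2 : serre 2 (quot_ring (ideal_mul I I)) -> False.
Proof.
have [ab ac ad [bc bd cd]] := neqs.
pose J := ideal_mul I I; pose z : {mpoly k[n]} := 'X_b * 'X_c * w ^+ 2.
have nw : ~ weight_ideal k C 1 w by apply: outer_vars_notin.
have abC : [set a; b] \subset C
  by rewrite /C -!finset.setUA !finset.setUA -finset.setUA finset.subsetUl.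
have cdC : [set c; d] \subset C by rewrite /C -finset.setUA finset.subsetUr.
(* The chain P_ab < P_abc < P_abcd forces depth 2 at P_abcd. *)
pose D (i : nat) := match i with 0 => [set a; b] | 1 => [set a; b;
  c] | _ => C end.
have abD i : [set a; b] \subset D i.
  by case: i => [|[|i]] //=; rewrite finset.subsetUl.
have JD i := cover_square_sub abG (abD i).
move=> S2; have : enat_le (Some 2%N) (depth (localization (push_prime (JD
  2%N)))).
  apply: (serre2_depth (c := fun i => push_prime (JD i))) => //.
  apply: push_var_chain => -[|[|//]] _; apply/properP; split;
    try exact: finset.subsetUl.
    by exists c; rewrite !inE ?eqxx ?orbT // negb_or ![c == _]eq_sym ac bc.
  by exists d; rewrite !inE ?eqxx ?orbT // !negb_or ![d == _]eq_sym ad bd cd.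
move=> /depth_localization_ge2_inv[x1 [x2 []]].
elim/quot_projW: x1 => f1; elim/quot_projW: x2 => f2.
move=> /push_primeP/split_pair_decomp[g1 [h1 [g1ab h1cd e1]]].
move=> /push_primeP/split_pair_decomp[g2 [h2 [g2ab h2cd e2]]] reg1 reg2.
have zJ g h : weight_ideal k [set a; b] 1 g -> weight_ideal k [set c; d] 1 h ->
    J (g * h * z) by apply: split_pair_square.
(* Modulo I^2 both f2 z h1 and f1 z h2 vanish, because g h z does for g in P_ab and h in P_cd.
   Regularity of f2 modulo f1 then yields [t] with v z h1 = t f1 modulo I^2. *)
have [||v] := reg2 (quot_proj _ (z * h1)) 1.
- exact: prime1.
- rewrite mul1r quot_mulE; apply/quot_divides; exists (z * h2).
  have -> : f2 * (z * h1) - z * h2 * f1 = g2 * h1 * z - g1 * h2 * z.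
    by rewrite e1 e2; ring.
  by apply: ideal_sub; apply: zJ.
elim/quot_projW: v => v nv; rewrite quot_mulE => /quot_divides[t Jt].
have {}nv : ~ weight_ideal k C 1 v by move=> Cv; apply: nv; apply/push_primeP.
have reg g : J (f1 * g) -> exists2 u, ~ weight_ideal k C 1 u & J (u * g).
  move=> Jg; have [||u] := reg1 (quot_proj _ g) 1; first exact: prime1.
    by rewrite mul1r quot_mulE; apply/quot_proj0P.
  elim/quot_projW: u => u nu; rewrite quot_mulE => /quot_proj0P Ju.
  by exists u => // Cu; apply: nu; apply/push_primeP.
(* Since x_a lies in P_ab, f1 kills t x_a modulo I^2; so t x_a lies locally in I^2, and x_a is a
   unit at P_cd. *)
have tcd : weight_ideal k [set c; d] 2 t.
  have [|u nu Ju] := reg (t * 'X_a).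
    have -> : f1 * (t * 'X_a) = 'X_a * h1 * z * v - (v * (z * h1) - t * f1) *
      'X_a by ring.
    apply: ideal_sub; apply: ideal_mulr => //.
    by apply: zJ => //; apply/weight_idealXU; rewrite !inE eqxx.
  have := cover_square_weight cdG Ju.
  move/(weight_idealM_cancel (fun h => nu (weight_subset cdC h))).
  rewrite mulrC; apply: weight_idealM_cancel => /weight_idealXU.
  by rewrite !inE (negbTE ac) (negbTE ad).
(* Symmetrically, f1 times x_d (v z - t) equals g1 x_d z v modulo I^2, which vanishes, and x_d is a
   unit at P_ab. *)
have tab : weight_ideal k [set a; b] 2 (v * z - t).
  have [|u nu Ju] := reg ('X_d * (v * z - t)).
    have -> : f1 * ('X_d * (v * z - t)) =
       g1 * 'X_d * z * v + (v * (z * h1) - t * f1) * 'X_d by rewrite e1; ring.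
    apply: idealD; apply: ideal_mulr => //.
    by apply: zJ => //; apply/weight_idealXU; rewrite !inE eqxx orbT.
  have := cover_square_weight abG Ju.
  move/(weight_idealM_cancel (fun h => nu (weight_subset abC h))).
  apply: weight_idealM_cancel => /weight_idealXU.
  by rewrite !inE eq_sym (negbTE ad) eq_sym (negbTE bd).
have nvw : ~ weight_ideal k C 1 (v * w ^+ 2).
  by rewrite expr2 => /(weight_idealM_cancel nv)/(weight_idealM_cancel nw).
apply: nvw => m; rewrite mcoeff_msupp lt0n; apply: contra_neqN => /eqP m0.
have mC i : i \in C -> m i = 0%N.
  by move=> iC; move/eqP: m0; rewrite sum_nat_eq0 => /forallP/(_ i);
    rewrite iC => /eqP.
have coef0 E f : weight_ideal k E 2 f ->
  weight E (U_(b) + U_(c) + m)%MM = 1%N ->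
    f@_(U_(b) + U_(c) + m) = 0.
  move=> Ef e; apply/eqP; rewrite mcoeff_eq0; apply/negP => /Ef.
  by rewrite e.
(* For [m] free of the variables of [C], x_b x_c m has weight 1 in both {a, b} and {c, d}; so it
   occurs neither in t nor in v z - t, hence not in their sum v z. *)
rewrite -(mcoeffMX _ (U_(b) + U_(c))%MM) mpolyXD.
have -> : v * w ^+ 2 * ('X_b * 'X_c) = (v * z - t) + t by rewrite /z; ring.
rewrite mcoeffD (coef0 _ _ tab) ?(coef0 _ _ tcd) ?addr0 //.
- rewrite weight_set2 // !mnmDE !mnm1E !mC ?inE ?eqxx ?orbT //.
  by rewrite (negbTE bc) (negbTE bd) (negbTE cd).
- rewrite weight_set2 // !mnmDE !mnm1E !mC ?inE ?eqxx ?orbT //.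
  by rewrite ![_ == a]eq_sym (eq_sym c b) (negbTE ab) (negbTE ac) (negbTE bc).
Qed.

End SplitPair.

End CoverSquare.

(** * Complete bipartite graphs *)

Lemma prime_ideal_prod (R : comPzRingType) (P : prime_ideal R) (T : eqType)
    (s : seq T) (F : T -> R) :
  P (\prod_(i <- s) F i) -> exists2 i, i \in s & P (F i).
Proof.
elim: s => [|i s IH]; first by rewrite big_nil => /prime1.
rewrite big_cons => /primeM[Pi|/IH[j js Pj]].
  by exists i; rewrite ?mem_head.
by exists j; rewrite // inE js orbT.
Qed.

Section Bipartition.
Variables (n : nat) (G : {set {set 'I_n}}).
Hypothesis hG : is_graph G.
Implicit Types (a b c d x y : 'I_n) (A B E : {set 'I_n}).

Definition complete_bipartite A B :=
  [/\ forall x y, x \in A -> y \in B -> [set x; y] \in G,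
      forall E, E \in G -> exists x y, [/\ x \in A, y \in B & E = [set x; y]]
    & exists x y, x \in A /\ y \in B].

Hypothesis no_triangle : forall a b c, ~~ triangle G a b c.
Hypothesis no_split_pair : forall a b c d, ~~ split_pair G a b c d.

Let neq := edge_neq hG.

Let no_triangle' a b c :
  [set a; b] \in G -> [set b; c] \in G -> [set a; c] \in G -> False.
Proof. by move=> ab bc ac; case/negP: (no_triangle a b c); apply/and3P. Qed.

Let no_split_pair' a b c d : a != c -> a != d -> b != c -> b != d ->
  [set a; b] \in G -> [set c; d] \in G ->
  [set a; c] \notin G -> [set a; d] \notin G -> [set b; d] \notin G -> False.
Proof.
move=> ac ad bc bd ab cd nac nad nbd; case/negP: (no_split_pair a b c d).
rewrite /split_pair ab cd nac nad nbd /= !inE !negb_or.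
by rewrite ac ad bc bd !neq.
Qed.

(** Otherwise the four vertices are distinct and [d] is adjacent to at most one of [a], [b], there
    being no triangle; in either case a split pair appears. *)
Let edge_meets a b c d : [set a; b] \in G -> [set c; d] \in G ->
  [set c; a] \in G \/ [set c; b] \in G.
Proof.
move=> ab cd; apply: contrapT => /not_orP[/negP ca /negP cb].
have c_a : c != a by apply: contraNneq cb => ->.
have c_b : c != b by apply: contraNneq ca => ->; rewrite edgeC.
have d_a : d != a by apply: contraNneq ca => <-.
have d_b : d != b by apply: contraNneq cb => <-.
have [db|db] := boolP ([set d; b] \in G).
  have [da|da] := boolP ([set d; a] \in G).
    exact: (no_triangle' da ab db).
  by apply: (@no_split_pair' c d b a); rewrite // edgeC.
exact: (@no_split_pair' c d a b).
Qed.

Lemma complete_bipartite_of_edge a b : [set a; b] \in G ->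
  exists A B, complete_bipartite A B.
Proof.
(* The sides are the neighbours of [b] and the neighbours of [a]. *)
move=> ab; exists [set x | [set x; b] \in G]%SET, [set y | [set a;
  y] \in G]%SET.
split=> [x y|E EG|]; last by exists a, b; rewrite !inE.
  rewrite !inE => xb ay; have [->|xa] := eqVneq x a; first exact: ay.
  have [->|yb] := eqVneq y b; first exact: xb.
  apply: contrapT => /negP xy; apply: (@no_split_pair' x b a y) => //.
  - apply/eqP => e; move: ay; rewrite -e => ax.
    by apply: (no_triangle' ax xb ab).
  - by rewrite eq_sym neq.
  - by rewrite eq_sym.
  - by apply/negP => xa'; apply: (no_triangle' xa' ab xb).
  - by apply/negP => by'; apply: (no_triangle' ab by' ay).
have E2 : #|E| == 2%N by rewrite (hG EG).
have /cards2P[c [d [cd eE]]] := E2.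
rewrite {}eE in EG *; have dc : [set d; c] \in G by rewrite edgeC.
(* Each end of the edge is adjacent to [a] or to [b]; both to the same one would make a triangle. *)
case: (edge_meets ab EG) => h1; case: (edge_meets ab dc) => h2.
- by case: (no_triangle' EG h2 h1).
- by exists d, c; rewrite !inE h2 edgeC h1 finset.setUC.
- by exists c, d; rewrite !inE h1 edgeC h2.
- by case: (no_triangle' EG h2 h1).
Qed.

End Bipartition.

(** * Filtration of R/(u, v)^2 for coprime monomials u and v *)

Section Pairs.
Variables (k : fieldType) (n : nat).
Local Notation R := {mpoly k[n]}.
Implicit Types (p q w f : R) (s t : seq 'I_n).

Definition pair_ideal p q : ideal R := ideal_gen (fun r => r \in [:: p; q]).

Lemma pair_idealP p q f : pair_ideal p q f <-> exists c d, f = c * p + d * q.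
Proof. exact: ideal_gen_seq2. Qed.

Lemma pair_idealC p q : pair_ideal p q = pair_ideal q p.
Proof.
congr ideal_gen; apply/funext => r; apply/propext.
by rewrite !inE orbC.
Qed.

Definition mono s : R := \prod_(i <- s) 'X_i.

Lemma mpolyX_neq0 i : 'X_i != 0 :> R.
Proof. by apply/eqP => /(congr1 (mcoeff U_(i))); rewrite mcoeffX mcoeff0 eqxx;
  apply/eqP/oner_neq0. Qed.

Lemma mono_neq0 s : mono s != 0.
Proof.
by rewrite /mono prodf_seq_neq0; apply/allP => i _; apply: mpolyX_neq0.
Qed.

Lemma divides_varP i f : divides 'X_i f <-> weight_ideal k [set i] 1 f.
Proof.
rewrite -var_idealP; split=> [[c ->]|[s [sX ->]]].
  by apply: idealM; apply: ideal_gen_mem; exists i; rewrite // inE.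
elim: s sX => [|p s IH] sX; first by rewrite big_nil; exists 0; rewrite mul0r.
rewrite big_cons; apply: dividesD; last by apply: IH => q qs; apply: sX;
  rewrite inE qs orbT.
have [j] := sX p (mem_head _ _); rewrite inE => /eqP -> ->.
by exists p.1.
Qed.

(** Each variable of [s] is prime and does not divide [mono t], so it can be split off [f].
    Repetitions in the lists are allowed, which serves for squares. *)
Lemma mono_coprime s t f : (forall i, i \in s -> i \notin t) ->
  divides (mono s) (f * mono t) -> divides (mono s) f.
Proof.
elim: s f => [|i s IH] f st; first by exists f; rewrite /mono big_nil mulr1.
rewrite /mono big_cons -!/(mono _) => -[c e].
have [f' ef] : divides 'X_i f.
  apply/divides_varP.
  have : weight_ideal k [set i] 1 (mono t * f).
    by apply/divides_varP; exists (c * mono s); rewrite mulrC e; ring.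
  apply: weight_idealM_cancel =>
    /(prime_ideal_prod (P := var_prime k [set i]))[j jt].
  move/weight_idealXU; rewrite inE => /eqP ej.
  by move: (st i (mem_head _ _)); rewrite -ej jt.
have [|d ed] := IH f' (fun j js => st j (mem_behead (s := i :: s) js)).
  by exists c; apply: (mulfI (mpolyX_neq0 i)); move: e; rewrite ef => e;
    rewrite -[RHS]mulrCA -e; ring.
by exists d; rewrite ef ed; ring.
Qed.

Definition coprime_to w q := forall f, divides w (f * q) -> divides w f.

(** The colon ideal (pw, q) : w is (p, q) because [w] is coprime to [q]. *)
Lemma pair_extension p q w : w != 0 -> coprime_to w q ->
  mod_extension (pair_ideal (p * w) q) (pair_ideal w q) (pair_ideal p q) w.
Proof.
move=> w0 wq; split=> [f|||c].
- by move=> /pair_idealP[c [d ->]]; apply/pair_idealP; exists (c * p), d; ring.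
- by apply/pair_idealP; exists 1, 0; ring.
- move=> f /pair_idealP[c [d ->]]; exists c.
  by apply/pair_idealP; exists 0, d; ring.
split=> /pair_idealP[x [y e]]; apply/pair_idealP; last first.
  by exists x, (y * w); rewrite e; ring.
have [|y' ey] := wq y.
  by exists (c - x * p); rewrite mulrBl e; ring.
exists x, y'; apply: (mulIf w0); rewrite e ey; ring.
Qed.

(** The colon ideal (p, q)^2 : q is (p, q): in a relation c q = c1 p^2 + c2 p q + c3 q^2,
    coprimality makes [q] divide c1. *)
Lemma square_extension p q : q != 0 -> coprime_to q (p ^+ 2) ->
  mod_extension (ideal_mul (pair_ideal p q) (pair_ideal p q))
    (pair_ideal (p ^+ 2) q) (pair_ideal p q) q.
Proof.
move=> q0 qp.
have sqP f : ideal_mul (pair_ideal p q) (pair_ideal p q) f <->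
    exists c1 c2 c3, f = c1 * p ^+ 2 + c2 * p * q + c3 * q ^+ 2.
  split=> [[s [sX ->]]|[c1 [c2 [c3 ->]]]].
    elim: s sX => [|x s IH] sX; first by exists 0, 0, 0; rewrite big_nil; ring.
    have [|c1 [c2 [c3 e]]] := IH; first by move=> y ys; apply: sX;
      rewrite inE ys orbT.
    have [a [b [/pair_idealP[a1 [a2 ->]] /pair_idealP[b1 [b2 ->]] ex]]] :=
      sX x (mem_head _ _).
    rewrite big_cons e ex.
    exists (x.1 * a1 * b1 + c1), (x.1 * (a1 * b2 + a2 * b1) + c2),
      (x.1 * a2 * b2 + c3).
    by ring.
  have Ip : pair_ideal p q p by apply/pair_idealP; exists 1, 0; ring.
  have Iq : pair_ideal p q q by apply/pair_idealP; exists 0, 1; ring.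
  have II a b : pair_ideal p q a -> pair_ideal p q b ->
      ideal_mul (pair_ideal p q) (pair_ideal p q) (a * b).
    by move=> Ia Ib; apply: ideal_gen_mem; exists a, b.
  rewrite !expr2 -(mulrA c2); apply: idealD; last exact/idealM/II.
  by apply: idealD; apply: idealM; apply: II.
split=> [f|||c].
- move=> /sqP[c1 [c2 [c3 ->]]]; apply/pair_idealP; exists c1, (c2 * p + c3 * q);
    ring.
- by apply/pair_idealP; exists 0, 1; ring.
- move=> f /pair_idealP[c [d ->]]; exists d.
  by apply/sqP; exists c, 0, 0; ring.
split=> [/sqP[c1 [c2 [c3 e]]]|/pair_idealP[x [y ->]]]; last first.
  by apply/sqP; exists 0, x, y; ring.
have [|c' ec] := qp c1.
  by exists (c - c2 * p - c3 * q); rewrite !mulrBl e; ring.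
apply/pair_idealP; exists (c' * p + c2), c3.
by apply: (mulIf q0); rewrite e ec; ring.
Qed.

(** Variables are removed first from [t] against a single x_i, then from [s], and finally the square
    is reduced to (u^2, v) and (u, v). Empty products give the unit ideal. *)
Lemma devissage (Phi : ideal R -> Prop) s t :
  (forall (J J' K : ideal R) w, mod_extension J J' K w -> Phi J' -> Phi K ->
    Phi J) ->
  (forall J : ideal R, J 1 -> Phi J) ->
  (forall i j, i \in s -> j \in t -> Phi (pair_ideal 'X_i 'X_j)) ->
  (forall i, i \in s -> i \notin t) ->
  Phi (ideal_mul (pair_ideal (mono s) (mono t)) (pair_ideal (mono s) (mono t))).
Proof.
move=> ext triv base st.
have ts j : j \in t -> j \notin s by move=> jt; apply/negP => /st; rewrite jt.
have one q : Phi (pair_ideal (mono [::]) q).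
  by apply: triv; apply/pair_idealP; exists 1, 0; rewrite /mono big_nil; ring.
have step1 i t' : i \in s -> {subset t' <= t} ->
  Phi (pair_ideal 'X_i (mono t')).
  move=> i_s; elim: t' => [|j t' IH] sub; first by rewrite pair_idealC.
  have sub' : {subset t' <= t} by move=> j' h; apply: sub; rewrite inE h orbT.
  rewrite /mono big_cons pair_idealC; apply: ext (pair_extension _ _ _) _ _.
  - exact: mono_neq0.
  - have -> : 'X_i = mono [:: i] by rewrite /mono big_seq1.
    move=> f; apply: mono_coprime => j' /sub' j't; rewrite inE.
    by apply/eqP => e; move: (st i i_s); rewrite -e j't.
  - by rewrite pair_idealC; apply: IH.
  - by rewrite pair_idealC; apply: base => //; apply: sub; rewrite mem_head.
have step2 s' : {subset s' <= s} -> Phi (pair_ideal (mono s') (mono t)).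
  elim: s' => [|i s' IH] sub //.
  have sub' : {subset s' <= s} by move=> j' h; apply: sub; rewrite inE h orbT.
  rewrite {1}/mono big_cons; apply: ext (pair_extension _ _ _) _ _.
  - exact: mono_neq0.
  - by move=> f; apply: mono_coprime => j /sub'/st.
  - exact: IH.
  - by apply: step1 => //; apply: sub; rewrite mem_head.
(* As lists may repeat variables, [step2] also covers u^2. *)
have sq : mono s ^+ 2 = mono (s ++ s) by rewrite /mono big_cat.
apply: ext (square_extension _ _) _ _.
- exact: mono_neq0.
- move=> f; rewrite sq; apply: mono_coprime => j /ts.
  by rewrite mem_cat negb_or => ->.
- by rewrite sq; apply: step2 => j; rewrite mem_cat orbb.
- exact: step2.
Qed.

End Pairs.

Section Substitution.
Variables (k : fieldType) (n m : nat) (h : 'I_n -> {mpoly k[m]}).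

Definition subst : {rmorphism {mpoly k[n]} -> {mpoly k[m]}} :=
  mmap (@mpolyC m k) h.

Lemma substC c : subst c%:MP = c%:MP.
Proof. exact: mmapC. Qed.

Lemma substX i : subst 'X_i = h i.
Proof. by rewrite [LHS]mmapX mmap1U. Qed.

End Substitution.

Opaque subst.

(** * A common section of the projections onto R/(x_a, x_b) *)

Section Transversal.
Variables (k : fieldType) (n : nat) (A B : {set 'I_n}) (a0 b0 : 'I_n).
Hypotheses (a0A : a0 \in A) (b0B : b0 \in B).
Hypothesis AB : forall i, i \in A -> i \notin B.
Local Notation R := {mpoly k[n]}.
Local Notation pair a b := (pair_ideal ('X_a : R) 'X_b).

Let S := ~: [set a0; b0].
Local Notation T := {mpoly k[#|S|]}.

(* The variable of [T] corresponding to [i], or [0] if [i] is [a0] or [b0]. *)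
Let kappa (i : 'I_n) : T := \sum_(j < #|S| | enum_val j == i) 'X_j.

Let pivot (V : lmodType k) (a b : V) i : V :=
  if i \in A then a else if i \in B then b else 0.

Let section : {rmorphism T -> R} :=
  subst (fun j => 'X_(enum_val j) - pivot 'X_a0 'X_b0 (enum_val j)).

(** The projection with kernel (x_a, x_b), in coordinates where x_i goes to y_i - y_a on the side
    [A] and to y_i - y_b on [B]. As x_{a0} goes to -y_a, the difference x_i - x_{a0} goes to y_i for
    all [a]. *)
Let reduce a b : {rmorphism R -> T} :=
  subst (fun i => kappa i - pivot (kappa a) (kappa b) i).

Let kappa_enum_val j : kappa (enum_val j) = 'X_j.
Proof. by rewrite /kappa (big_pred1 j) // => i;
  rewrite (inj_eq enum_val_inj). Qed.

Let kappa0 i : i \notin S -> kappa i = 0.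
Proof.
move=> iS; rewrite /kappa big_pred0 // => j; apply: contraNF iS => /eqP <-.
exact: enum_valP.
Qed.

Let kappa_a0 : kappa a0 = 0.
Proof. by apply: kappa0; rewrite !inE eqxx. Qed.

Let kappa_b0 : kappa b0 = 0.
Proof. by apply: kappa0; rewrite !inE eqxx orbT. Qed.

Let BA i : i \in B -> (i \in A) = false.
Proof. by move=> iB; apply/negP => /AB; rewrite iB. Qed.

Let section_kappa i : section (kappa i) = 'X_i - pivot 'X_a0 'X_b0 i.
Proof.
have [iS|] := boolP (i \in S).
  by rewrite -(enum_rankK_in iS iS) kappa_enum_val /section substX.
move=> iS; rewrite kappa0 // rmorph0; move: iS.
rewrite !inE negbK => /orP[] /eqP ->; rewrite /pivot.
  by rewrite a0A subrr.
by rewrite (BA b0B) b0B subrr.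
Qed.

Section Reduce.
Variables a b : 'I_n.
Hypotheses (aA : a \in A) (bB : b \in B).

Let reduceX i : reduce a b 'X_i = kappa i - pivot (kappa a) (kappa b) i.
Proof. exact: substX. Qed.

Lemma reduce_section : cancel section (reduce a b).
Proof.
move=> f; apply: (@mpoly_rmorph_ext _ _ _ (reduce a b \o section) idfun) =>
  [c|j] /=.
  by rewrite [section _]substC; apply: substC.
rewrite [section _]substX rmorphB reduceX kappa_enum_val /pivot.
case: ifP => [_|_].
  by rewrite reduceX /pivot a0A kappa_a0 sub0r opprK subrK.
case: ifP => [_|_]; last by rewrite rmorph0 !subr0.
by rewrite reduceX /pivot (BA b0B) b0B kappa_b0 sub0r opprK subrK.
Qed.

(** On a variable the difference is x_a, x_b or 0, and the property passes to sums and products. *)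
Lemma section_reduce f : pair a b (f - section (reduce a b f)).
Proof.
have Ka : pair a b 'X_a by apply/pair_idealP; exists 1, 0; ring.
have Kb : pair a b 'X_b by apply/pair_idealP; exists 0, 1; ring.
elim/mpoly_ring_ind: f => [c|i|f g Kf Kg|f g Kf Kg].
- by rewrite [reduce _ _ _]substC [section _]substC subrr; apply: ideal0.
- rewrite reduceX rmorphB section_kappa /pivot.
  case: ifP => iA.
    rewrite section_kappa /pivot aA.
    by have -> : 'X_i - ('X_i - 'X_a0 - ('X_a - 'X_a0)) = 'X_a :> R by ring.
  case: ifP => iB; last by rewrite rmorph0 !subr0 subrr; apply: ideal0.
  rewrite section_kappa /pivot (BA bB) bB.
  by have -> : 'X_i - ('X_i - 'X_b0 - ('X_b - 'X_b0)) = 'X_b :> R by ring.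
- rewrite !rmorphD.
  move: (section (reduce a b f)) (section (reduce a b g)) Kf Kg => f' g' Kf Kg.
  have -> : f + g - (f' + g') = (f - f') + (g - g') by ring.
  exact: idealD.
- rewrite !rmorphM.
  move: (section (reduce a b f)) (section (reduce a b g)) Kf Kg => f' g' Kf Kg.
  have -> : f * g - f' * g' = f * (g - g') + g' * (f - f') by ring.
  by apply: idealD; apply: idealM.
Qed.

Lemma reduce_eq0 f : pair a b f <-> reduce a b f = 0.
Proof.
split=> [/pair_idealP[c [d ->]]|e]; last first.
  by rewrite -[f]subr0 -[0](rmorph0 section) -e; apply: section_reduce.
rewrite rmorphD !rmorphM !reduceX /pivot aA (BA bB) bB /=.
by rewrite !subrr !mulr0 addr0.
Qed.

Lemma section_mod_regular1 t : t != 0 -> mod_regular1 (pair a b) (section t).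
Proof.
move=> t0 f /reduce_eq0; rewrite rmorphM reduce_section => /eqP.
by rewrite mulf_eq0 (negbTE t0) => /eqP/reduce_eq0.
Qed.

(** On R/(x_a, x_b) = T the two elements act as [p] and [q], and a prime [p] not dividing [q] makes
    [q] regular modulo [p]. *)
Lemma section_mod_regular2 p q : prime_elt p -> ~ divides p q ->
  mod_regular2 (pair a b) (section p) (section q).
Proof.
move=> [p0 pP] pq; split=> [|f [c /reduce_eq0]].
  exact: section_mod_regular1.
rewrite rmorphB !rmorphM !reduce_section => /eqP; rewrite subr_eq0 => /eqP e.
case: (pP q (reduce a b f)) => [|/pq //|[d ed]]; first by exists (reduce a b c).
exists (section d); apply/reduce_eq0.
by rewrite rmorphB rmorphM !reduce_section ed subrr.
Qed.

End Reduce.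

(** As Q0 contains x_{a0} and x_{b0}, replacing [f] by the section of its reduction changes it only
    by an element of Q0. *)
Lemma transversal_regular1 (Q0 Q1 : prime_ideal R) f :
  Q0 'X_a0 -> Q0 'X_b0 -> (forall g, Q0 g -> Q1 g) -> Q1 f -> ~ Q0 f ->
  exists2 r, Q1 r & forall a b, a \in A -> b \in B -> mod_regular1 (pair a b) r.
Proof.
move=> Qa Qb Q01 Q1f nf.
have K0 g : pair a0 b0 g -> Q0 g.
  by move=> /pair_idealP[c [d ->]]; apply: idealD; apply: idealM.
exists (section (reduce a0 b0 f)).
  rewrite -[section _](subKr f); apply: ideal_sub => //.
  exact/Q01/K0/section_reduce.
move=> a b aA bB; apply: section_mod_regular1 => //.
by apply/eqP => /(reduce_eq0 a0A b0B) /K0.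
Qed.

Lemma transversal_regular2 (Q0 Q1 Q2 : prime_ideal R) f g :
  Q0 'X_a0 -> Q0 'X_b0 -> (forall h, Q0 h -> Q1 h) -> (forall h, Q1 h ->
    Q2 h) ->
  Q1 f -> ~ Q0 f -> Q2 g -> ~ Q1 g ->
  exists r1 r2, [/\ Q2 r1, Q2 r2 & forall a b, a \in A -> b \in B ->
    mod_regular2 (pair a b) r1 r2].
Proof.
move=> Qa Qb Q01 Q12 Q1f nf Q2g ng.
have K0 h : pair a0 b0 h -> Q0 h.
  by move=> /pair_idealP[c [d ->]]; apply: idealD; apply: idealM.
have cong h : Q0 (h - section (reduce a0 b0 h)) by exact/K0/section_reduce.
have f0 : reduce a0 b0 f != 0 by apply/eqP => /(reduce_eq0 a0A b0B) /K0.
have [s [sP es]] := factorial_mpoly f0.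
(* The product of the sections of the prime factors is congruent to [f] modulo Q0, so the prime Q1
   contains one of them. *)
have [p ps Q1p] : exists2 p, p \in s & Q1 (section p).
  apply: prime_ideal_prod; rewrite -rmorph_prod -es -[section _](subKr f).
  by apply: ideal_sub => //; apply/Q01/cong.
exists (section p), (section (reduce a0 b0 g)); split.
- exact: Q12.
- by rewrite -[section _](subKr g); apply: ideal_sub => //; apply/Q12/Q01/cong.
move=> a b aA bB; apply: section_mod_regular2 => //; first exact: sP.
move=> [c e]; apply: ng; rewrite -[g](subrK (section (reduce a0 b0 g))).
by apply: idealD; [apply/Q01/cong | rewrite e rmorphM; apply: idealM].
Qed.

End Transversal.

(** * The cover ideal of a complete bipartite graph *)

Section CompleteBipartite.
Variables (k : fieldType) (n : nat) (G : {set {set 'I_n}}) (A B : {set 'I_n}).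
Hypotheses (hG : is_graph G) (bip : complete_bipartite G A B).
Local Notation R := {mpoly k[n]}.
Local Notation I := (cover_ideal k G).

Let AB i : i \in A -> i \notin B.
Proof.
have [edges _ _] := bip; move=> iA; apply/negP => iB.
by have := edge_neq hG (edges i i iA iB); rewrite eqxx.
Qed.

Let u : R := mono k (enum A).
Let v : R := mono k (enum B).

Lemma mono_divides (C : {set 'I_n}) (m : 'X_{1..n}) : (forall i, i \in C ->
  m i != 0%N) ->
  divides (mono k (enum C)) 'X_[m].
Proof.
move=> mC; rewrite mpolyXE_id (bigID (mem C)) /mono big_enum /=;
  apply: dividesMr.
exists (\prod_(i in C) 'X_i ^+ (m i).-1); rewrite -big_split.
by apply: eq_bigr => i /mC; rewrite /= -exprSr -lt0n => /prednK ->.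
Qed.

(** A monomial of I that misses some x in [A] must contain every y in [B], on account of the edges
    xy. *)
Lemma cover_ideal_bipartite : I = pair_ideal u v :> set R.
Proof.
have [edges all_edges _] := bip.
apply/funext => f; apply/propext; split=> [If|/pair_idealP[c [d ->]] E];
  last first.
  move=> /all_edges[x [y [xA yB ->]]]; apply/var_idealP.
  apply: idealD; apply: idealM; rewrite /u /v /mono big_enum.
    by rewrite (bigD1 x) //; apply: ideal_mulr; apply/weight_idealXU;
      rewrite !inE eqxx.
  by rewrite (bigD1 y) //; apply: ideal_mulr; apply/weight_idealXU;
    rewrite !inE eqxx orbT.
rewrite [f]mpolyE big_seq; apply: (big_ind (pair_ideal u v)) => [||m mf].
- exact: ideal0.
- exact: idealD.
rewrite -mul_mpolyC; apply: idealM.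
have [mA|/existsNP[x /not_implyP[xA /negP mx]]] :=
  pselect (forall i, i \in A -> m i != 0%N).
  by have [c ->] := mono_divides mA; apply/pair_idealP; exists c, 0;
    rewrite mul0r addr0.
suff [c ->] : divides v 'X_[m].
  by apply/pair_idealP; exists 0, c; rewrite mul0r add0r.
apply: mono_divides => y yB; move: mx; rewrite negbK => /eqP mx.
have xy := edge_neq hG (edges x y xA yB).
have := cover_ideal_weight (edges x y xA yB) If mf.
by rewrite weight_set2 // mx lt0n.
Qed.

Lemma bipartite_complete_intersection : complete_intersection I.
Proof.
exists [:: u; v]; split; last exact: cover_ideal_bipartite.
apply/regular_seq2; split=> [f /eqP|f d].
  by rewrite mulf_eq0 (negbTE (mono_neq0 _ _)) => /eqP.
apply: (@mono_coprime _ _ _ (enum B)); last by rewrite mulrC.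
by move=> i; rewrite !mem_enum; apply: AB.
Qed.

Let square_devissage (Phi : ideal R -> Prop) :
  (forall (J J' K : ideal R) w, mod_extension J J' K w -> Phi J' -> Phi K ->
    Phi J) ->
  (forall J : ideal R, J 1 -> Phi J) ->
  (forall a b, a \in A -> b \in B -> Phi (pair_ideal 'X_a 'X_b)) ->
  Phi (ideal_mul I I).
Proof.
move=> ext triv base.
have : Phi (ideal_mul (pair_ideal u v) (pair_ideal u v)).
  apply: devissage => // [i j|i]; rewrite !mem_enum; [exact: base|exact: AB].
(* [ideal_mul] depends on its arguments only as sets, so the equality of sets is enough. *)
by rewrite /ideal_mul cover_ideal_bipartite.
Qed.

Lemma bipartite_serre2 : serre 2 (quot_ring (ideal_mul I I)).
Proof.
set J := ideal_mul I I.
(* A prime containing I^2 contains u and v, hence a variable from each side. *)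
have vars (P : prime_ideal (quot_ring J)) : exists a b,
    [/\ a \in A, b \in B, pull_prime P 'X_a & pull_prime P 'X_b].
  have II f : I f -> pull_prime P f.
    move=> If; suff /primeM[]: pull_prime P (f * f) by [].
    by apply: pull_prime_sub; apply: ideal_gen_mem; exists f, f.
  have [|a] := @prime_ideal_prod _ (pull_prime P) _ (enum A) (fun i => 'X_i).
    apply: II; rewrite -[I _]/((I : set R) _) cover_ideal_bipartite.
    by apply/pair_idealP; exists 1, 0; rewrite mul1r mul0r addr0.
  rewrite mem_enum => aA Pa.
  have [|b] := @prime_ideal_prod _ (pull_prime P) _ (enum B) (fun i => 'X_i).
    apply: II; rewrite -[I _]/((I : set R) _) cover_ideal_bipartite.
    by apply/pair_idealP; exists 0, 1; rewrite mul1r mul0r add0r.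
  by rewrite mem_enum => bB Pb; exists a, b.
have strict (P Q : prime_ideal (quot_ring J)) : proper P Q ->
    (forall f, pull_prime P f -> pull_prime Q f) /\
    exists f, pull_prime Q f /\ ~ pull_prime P f.
  move=> [PQ nQP]; split=> [f|]; first exact: PQ.
  apply: contrapT => h; apply: nQP => x; elim/quot_projW: x => f Qf.
  by apply: contrapT => nPf; apply: h; exists f.
apply: serre2_suff => [P0 P1|P0 P1 P2] /strict[P01 [f [P1f nf]]].
  have [a0 [b0 [a0A b0B Pa Pb]]] := vars P0.
  have [r P1r reg] := transversal_regular1 a0A b0B AB Pa Pb P01 P1f nf.
  exists (quot_proj J r) => //; apply: quot_regular1.
  apply: (square_devissage (Phi := fun K => mod_regular1 K r)) =>
    // [L L' K w|L L1 g _].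
    exact: mod_regular1_ext.
  by rewrite -[g]mulr1; apply: idealM.
move=> /strict[P12 [g [P2g ng]]].
have [a0 [b0 [a0A b0B Pa Pb]]] := vars P0.
have [r1 [r2 [P2r1 P2r2 reg]]] :=
  transversal_regular2 a0A b0B AB Pa Pb P01 P12 P1f nf P2g ng.
exists (quot_proj J r1), (quot_proj J r2); split=> //; apply: quot_regular2.
apply: (square_devissage (Phi := fun K => mod_regular2 K r1 r2)) =>
  // [L L' K w|L L1].
  exact: mod_regular2_ext.
have L_all h : L h by rewrite -[h]mulr1; apply: idealM.
by split=> // h _; exists 0.
Qed.

End CompleteBipartite.

Lemma graph_dichotomy (n : nat) (G : {set {set 'I_n}}) : is_graph G ->
  (forall a b c, ~~ triangle G a b c) ->
  (forall a b c d, ~~ split_pair G a b c d) ->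
  G = finset.set0 \/ exists A B, complete_bipartite G A B.
Proof.
move=> hG nt ns; case: (finset.set_0Vmem G) => [->|[E EG]]; [by left | right].
have E2 : #|E| == 2%N by rewrite (hG E EG).
have /cards2P[a [b [_ e]]] := E2.
by rewrite e in EG; apply: complete_bipartite_of_edge EG.
Qed.

(** The empty intersection is the unit ideal, and the zero ring has no primes. *)
Lemma cover_ideal_empty_serre (k : fieldType) n l :
  serre l (quot_ring (ideal_mul (cover_ideal k (finset.set0 : {set {set 'I_n}}))
                                (cover_ideal k finset.set0))).
Proof.
set I := cover_ideal _ _ => P; case: (@prime1 _ (pull_prime P)).
apply: pull_prime_sub; rewrite -[1]mulr1; apply: ideal_gen_mem; exists 1, 1.
by split=> // C; rewrite inE.
Qed.

Lemma cover_ideal_empty_complete_intersection (k : fieldType) n :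
  complete_intersection (cover_ideal k (finset.set0 : {set {set 'I_n}})).
Proof.
exists [:: 1]; split; first by apply/regular_seq1 => a; rewrite mul1r.
apply/funext => f; apply/propext; split=> [_|_ C]; last by rewrite inE.
by apply/ideal_gen_seq1; exists f; rewrite mulr1.
Qed.

Theorem theorem5p7 (k : fieldType) (n : nat) (G : {set {set 'I_n}})
    (hG : is_graph G) :
  serre 2 (quot_ring (ideal_mul (cover_ideal k G) (cover_ideal k G))) <->
  complete_intersection (cover_ideal k G).
Proof.
split=> h.
- have [| |->|[A [B bip]]] := graph_dichotomy hG.
  + by move=> a b c; apply/negP => /(triangle_not_serre2 hG); apply; exact: h.
  + by move=> a b c d; apply/negP => /(split_pair_not_serre2 hG); apply;
      exact: h.
  + exact: cover_ideal_empty_complete_intersection.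
  + exact: bipartite_complete_intersection bip.
- have [| |->|[A [B bip]]] := graph_dichotomy hG.
  + by move=> a b c; apply/negP => /(triangle_not_complete_intersection hG);
      apply; exact: h.
  + by move=> a b c d; apply/negP => /(split_pair_not_complete_intersection hG);
      apply; exact: h.
  + exact: cover_ideal_empty_serre.
  + exact: bipartite_serre2 bip.
Qed.
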